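(* Let $X$ be a zero-dimensional compact metrizable space. Then the following conditions are equivalent: (1) $X$ is a topological fractal; (2) $X$ is a Banach fractal; (3) $X$ is a Banach ultrafractal; (4) the scattered height $\hbar(X)$ of $X$ is not a countable (nonzero) limit ordinal; that is, $\hbar(X)$ is either $\infty$, or $0$, or a countable successor ordinal.
   Context: A topological space is zero-dimensional if it has a base of the topology consisting of closed-and-open subsets. Topological fractal: a Hausdorff topological space $X$ such that $X=\bigcup_{f\in\mathcal F}f(X)$ for some finite system $\mathcal F$ of continuous self-maps of $X$ which is topologically contracting: for every open cover $\mathcal U$ of $X$ there is $n\in\mathbb N$ such that for any maps $f_1,\dots,f_n\in\mathcal F$ the set $f_1\circ\dots\circ f_n(X)$ is contained in some set $U\in\mathcal U$. Banach fractal: a compact metrizable space $X$ such that $X=\bigcup_{f\in\mathcal F}f(X)$ for some finite system $\mathcal F$ of self-maps of $X$, all of which have Lipschitz constant $<1$ with respect to some (one and the same) metric generating the topology of $X$. Banach ultrafractal: a compact topological space $X$ such that $X=\bigcup_{f\in\mathcal F}f(X)$ for some finite family $\mathcal F$ of continuous self-maps of $X$ such that the indexed family $(f(X))_{f\in\mathcal F}$ is (pairwise) disjoint and for any $\varepsilon>0$ there is an ultrametric $d$ generating the topology of $X$ such that $\mathrm{Lip}(\mathcal F)=\sup_{f\in\mathcal F}\sup_{x\ne y}\frac{d(f(x),f(y))}{d(x,y)}<\varepsilon$ (a supremum over the empty set being $0$). An ultrametric is a metric $d$ with $d(x,z)\le\max\{d(x,y),d(y,z)\}$ for all $x,y,z$.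 Scattered height: for a topological space $X$ and $A\subset X$ let $A^{(1)}$ be the set of non-isolated points of $A$ (in the subspace topology). Put $X^{(0)}=X$ and, for every ordinal $\alpha>0$, $X^{(\alpha)}=\bigcap_{\beta<\alpha}(X^{(\beta)})^{(1)}$. Let $X^{(\infty)}=\bigcap_\alpha X^{(\alpha)}$ be the perfect kernel of $X$. For $x\in X\setminus X^{(\infty)}$ let $\hbar(x)$ be the unique ordinal with $x\in X^{(\hbar(x))}\setminus X^{(\hbar(x)+1)}$. A space is scattered if each of its nonempty subspaces has an isolated point. If $X$ is scattered, put $\hbar(X)=\sup\{\hbar(x):x\in X\}$ (with $\sup\emptyset=0$); if $X$ is not scattered, put $\hbar(X)=\infty$, where $\infty$ is larger than any ordinal. *)

(* Defs.v *)
From HB Require Import structures.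
From mathcomp Require Import all_boot all_order all_algebra.
From mathcomp Require Import all_classical all_reals all_analysis.

Set Implicit Arguments.
Unset Strict Implicit.
Unset Printing Implicit Defensive.

Import Order.TTheory GRing.Theory Num.Theory.

Local Open Scope classical_set_scope.
Local Open Scope ring_scope.

(* The library's [zero_dimensional] only asks clopen sets to separate points;
   it agrees with the following on compact Hausdorff spaces, not in general. *)
Definition has_clopen_base (X : topologicalType) : Prop :=
  exists2 B : set (set X), basis B & B `<=` clopen.

Definition is_metric (R : realType) (X : Type) (d : X -> X -> R) : Prop :=
  [/\ forall x y, 0 <= d x y,
      forall x y, d x y = 0 <-> x = y,
      forall x y, d x y = d y x
    & forall x y z, d x z <= d x y + d y z].

Definition is_ultrametric (R : realType) (X : Type) (d : X -> X -> R) : Prop :=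
  is_metric d /\ forall x y z, d x z <= Num.max (d x y) (d y z).

Definition generates_topology (R : realType) (X : topologicalType)
    (d : X -> X -> R) : Prop :=
  forall x : X,
    nbhs x = filter_from [set r : R | 0 < r] (fun r => [set y | d x y < r]).

Definition metrizable (R : realType) (X : topologicalType) : Prop :=
  exists d : X -> X -> R, is_metric d /\ generates_topology d.

(* The element 0 realizes the convention that a supremum over the empty set
   is 0; the quotients being nonnegative, it is harmless otherwise. *)
Definition Lip (R : realType) (X : Type) (d : X -> X -> R)
    (F : set (X -> X)) : \bar R :=
  ereal_sup (0%E |` [set l | exists f x y,
    [/\ F f, x <> y & l = (d (f x) (f y) / d x y)%:E]]).

Definition covered_by_images (X : Type) (F : set (X -> X)) : Prop :=
  [set: X] = \bigcup_(f in F) range f.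

Definition topologically_contracting (X : topologicalType)
    (F : set (X -> X)) : Prop :=
  forall U : set (set X), U `<=` open -> \bigcup_(V in U) V = [set: X] ->
    exists n : nat, forall fs : 'I_n -> X -> X, (forall i, F (fs i)) ->
      exists2 V, U V & range (\big[comp/idfun]_(i < n) fs i) `<=` V.

Definition topological_fractal (X : topologicalType) : Prop :=
  hausdorff_space X /\
  exists F : set (X -> X),
    [/\ finite_set F, forall f, F f -> continuous f,
        covered_by_images F & topologically_contracting F].

Definition Banach_fractal (R : realType) (X : topologicalType) : Prop :=
  [/\ compact [set: X], metrizable R X
    & exists F : set (X -> X),
      [/\ finite_set F, covered_by_images F
        & exists d : X -> X -> R,
          [/\ is_metric d, generates_topology d
            & forall f, F f -> (Lip d [set f] < 1)%E]]].

Definition Banach_ultrafractal (R : realType) (X : topologicalType) : Prop :=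
  compact [set: X] /\
  exists F : set (X -> X),
    [/\ finite_set F, forall f, F f -> continuous f, covered_by_images F,
        trivIset F (fun f => range f)
      & forall eps : R, 0 < eps ->
          exists d : X -> X -> R,
            [/\ is_ultrametric d, generates_topology d
              & (Lip d F < eps%:E)%E]].

(* Ordinals are represented by well-founded trees: [Ssup f] stands for the
   least ordinal that is strictly greater than every [f i].  Distinct trees may
   represent the same ordinal, equality of ordinals being [ord_eq]. *)
Inductive Ord : Type := Ssup (T : Type) (f : T -> Ord).

Definition ord_index (a : Ord) : Type := let: Ssup T _ := a in T.

Definition ord_child (a : Ord) : ord_index a -> Ord :=
  match a return ord_index a -> Ord with Ssup _ f => f end.

Fixpoint ord_le (a b : Ord) : Prop :=
  match a, b with
  | Ssup _ f, Ssup _ g => forall i, exists j, ord_le (f i) (g j)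
  end.

Definition zero_ord : Ord := Ssup (fun e : Empty_set => match e with end).

Definition succ_ord (a : Ord) : Ord := Ssup (fun _ : unit => a).

Definition ord_lt (a b : Ord) : Prop := ord_le (succ_ord a) b.

Definition ord_eq (a b : Ord) : Prop := ord_le a b /\ ord_le b a.

(* Every child of some [F i] lies strictly below [F i], and [F i] is the least
   ordinal above its children; hence this is the least upper bound of [F]. *)
Definition ord_sup (I : Type) (F : I -> Ord) : Ord :=
  Ssup (fun p : {i : I & ord_index (F i)} => ord_child (projT2 p)).

Definition is_zero_ord (a : Ord) : Prop := ord_eq a zero_ord.

Definition is_succ_ord (a : Ord) : Prop := exists b, ord_eq a (succ_ord b).

Definition is_limit_ord (a : Ord) : Prop := ~ is_zero_ord a /\ ~ is_succ_ord a.

Definition countable_ord (a : Ord) : Prop :=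
  exists g : nat -> Ord, forall b, ord_lt b a -> exists n, ord_eq b (g n).

Definition derived_set (X : topologicalType) (A : set X) : set X :=
  A `\` isolated A.

(* The intersection runs over the children of [a] only; [CB_derivativeE] below
   shows that it is the intersection over all ordinals [b] below [a]. *)
Fixpoint CB_derivative (X : topologicalType) (a : Ord) : set X :=
  match a with
  | Ssup T f => \bigcap_(i in [set: T]) derived_set (CB_derivative (f i))
  end.
Arguments CB_derivative X a : clear implicits.

Definition scattered (X : topologicalType) : Prop :=
  forall A : set X, A !=set0 -> isolated A !=set0.

Definition has_rank (X : topologicalType) (x : X) (a : Ord) : Prop :=
  CB_derivative X a x /\ ~ CB_derivative X (succ_ord a) x.

(* The ordinal [a] such that [has_rank x a], unique up to [ord_eq] when it
   exists, that is, when [x] is not in the perfect kernel; a dummy value on the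
   perfect kernel. *)
Definition rank (X : topologicalType) (x : X) : Ord :=
  match pselect (exists a, has_rank x a) with
  | left h => projT1 (cid h)
  | right _ => zero_ord
  end.

(* [None] is the value infinity. *)
Definition scattered_height (X : topologicalType) : option Ord :=
  if `[< scattered X >] then Some (ord_sup (@rank X)) else None.

Lemma ord_le_refl (a : Ord) : ord_le a a.
Proof. by elim: a => I f IH /= i; exists i. Qed.

Lemma ord_le_trans (a b c : Ord) : ord_le a b -> ord_le b c -> ord_le a c.
Proof.
elim: a b c => I f IH [J g] [K h] /= ab bc i.
have [j fg] := ab i; have [k gh] := bc j.
by exists k; exact: IH fg gh.
Qed.

Lemma CB_derivative_anti (X : topologicalType) (a b : Ord) :
  ord_le a b -> CB_derivative X b `<=` CB_derivative X a.
Proof.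
elim: a b => I f IH [J g] /= ab x gx i _.
have [j fg] := ab i; have [gjx ngjx] := gx j Logic.I.
split; first exact: IH fg _ gjx.
move=> [_ [V xV Vf]]; apply: ngjx; split; first exact/mem_set.
exists V => //; apply/seteqP; split => [y [Vy gy]|_ ->].
  by rewrite -Vf; split => //; exact: IH fg _ gy.
by split => //; exact: nbhs_singleton.
Qed.

(* Stated pointwise since [Ord] lives in too large a universe for [set Ord]. *)
Lemma CB_derivativeE (X : topologicalType) (a : Ord) (x : X) :
  CB_derivative X a x <->
  forall b, ord_lt b a -> derived_set (CB_derivative X b) x.
Proof.
split=> [ax b ba|].
  by have /(_ _ ax) /= /(_ tt Logic.I) := @CB_derivative_anti X _ _ ba.
case: a => T f /= fx i _; apply: (fx (f i)) => /= _.
by exists i; exact: ord_le_refl.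
Qed.

(* Main.v *)
Require Import Defs.
From HB Require Import structures.
From mathcomp Require Import all_boot all_order all_algebra.
From mathcomp Require Import all_classical all_reals all_analysis.

(** The key observation is that every space of admissible height is homeomorphic
    to a one-sided subshift, i.e. a shift-invariant closed set of infinite words
    over a finite alphabet: prefixing letters, followed by a retraction whenever
    the result leaves the subshift, gives maps with disjoint images which are
    [e]-Lipschitz for the ultrametric [e ^ (length of the common prefix)].

    To find the subshift, cut [X] into finitely many clopen pieces with a peak,
    a point whose rank exceeds that of all other points of the piece, where
    points of the perfect kernel have rank infinity and are allowed to exceed
    themselves.  A piece with its peak removed is the disjoint union of a
    sequence of smaller such pieces, its children.  Iterating yields a tree,
    whose nodes are coded by binary words [0^n1 1 0^n2 1 ...]; shift-invariance
    amounts to bounding the rank of every node by that of the node whose code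
    lacks the first letter.  Away from the root this only takes a suitable
    numbering of the children.  At the root the children must have
    non-increasing ranks [r_0 >= r_1 >= ...] with all of them below the top
    rank and cofinal in it, which is where the top rank has to have a
    predecessor (infinity counting as its own).

    Conversely, let the height be a limit [b], so that the set [P] of points of
    rank [b] is finite.  Points of rank at least [a] have preimages of rank at
    least [a] under the maps of a fractal, hence a point outside [P] of large
    rank has arbitrarily long backward orbits, and these stay close to backward
    orbits inside [P]; this contradicts topological contraction. *)

Set Implicit Arguments.
Unset Strict Implicit.
Unset Printing Implicit Defensive.

Import Order.TTheory GRing.Theory Num.Theory.

Local Open Scope classical_set_scope.

(** * Compactness *)

(** If [Q K] failed, the sets whose relative complement in [K] satisfies [Q] would form a proper
    filter, and a cluster point of it in [K] would contradict the local hypothesis. *)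
Lemma compact_induction (X : topologicalType) (K : set X)
    (Q : set X -> Prop) :
  compact K -> Q set0 -> (forall A B, A `<=` B -> Q B -> Q A) ->
  (forall A B, Q A -> Q B -> Q (A `|` B)) ->
  (forall x, K x -> exists2 N, nbhs x N & Q (K `&` N)) -> Q K.
Proof.
move=> cK Q0 Qsub QU Qloc; apply: contrapT => nQK.
pose F : set_system X := [set S | Q (K `\` S)].
have FF : ProperFilter F.
  split; first by rewrite /F /= setD0.
  split.
  - by rewrite /F /= setDT.
  - move=> P P' QP QP'; apply: Qsub (QU _ _ QP QP') => x [Kx nPx].
    have [Px|nP] := pselect (P x); last by left.
    by right; split => // P'x; apply: nPx.
  - by move=> P P' PP' QP; apply: Qsub QP => x [Kx nP'x]; split => // /PP'.
have FK : F K by rewrite /F /= setDv.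
have [x [Kx clx]] := cK F FF FK; have [N xN QN] := Qloc x Kx.
have FN : F (~` N).
  by apply: Qsub QN => y [Ky /= nNy]; split => //; apply: contrapT.
by have [y []] := clx _ _ FN xN.
Qed.

(** The finite intersection property for a chain: comparability lets the property of being missed by
    some [C i] pass to unions. *)
Lemma nested_closed_empty (X : topologicalType) (K : set X) (I : Type)
    (C : I -> set X) :
  compact K -> inhabited I -> (forall i, closed (C i)) ->
  (forall i j, C i `<=` C j \/ C j `<=` C i) ->
  (forall x, K x -> exists i, ~ C i x) -> exists i, K `&` C i = set0.
Proof.
move=> cK [i0] cC nest dC.
suff [i iK] : exists i, K `<=` ~` C i.
  by exists i; apply/seteqP; split => // x [/iK].
apply: (compact_induction (Q := fun S => exists i, S `<=` ~` C i)) => //.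
- by exists i0.
- by move=> A B AB [i Bi]; exists i => x /AB /Bi.
- move=> A B [i Ai] [j Bj]; have [ij|ji] := nest i j.
    by exists i => x [/Ai//|/Bj nCj /ij].
  by exists j => x [/Ai nCi /ji|/Bj].
- move=> x Kx; have [i nCi] := dC x Kx.
  exists (~` C i); last by exists i => y [].
  by apply: open_nbhs_nbhs; split => //; exact: closed_openC.
Qed.

Lemma closed_discrete_finite (X : topologicalType) (M : set X) :
  compact M -> (forall x, M x -> exists2 N, nbhs x N & M `&` N `<=` [set x]) ->
  finite_set M.
Proof.
move=> cM dM; apply: compact_induction => //.
- by move=> A B AB; exact: sub_finite_set.
- by move=> A B fA fB; rewrite finite_setU.
- move=> x Mx; have [N xN MN] := dM x Mx; exists N => //.
  exact: sub_finite_set MN (finite_set1 x).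
Qed.

Lemma closed_compact_space (X : topologicalType) (A : set X) :
  compact [set: X] -> closed A -> compact A.
Proof. by move=> cX clA; exact: subclosed_compact clA cX _. Qed.

(** * Ordinals and Cantor-Bendixson derivatives *)

Section Ordinals.
Implicit Types a b c : Ord.

Lemma ord_le_total a b : ord_le a b \/ ord_le b a.
Proof.
elim: a b => I f IH [J g].
have [|nab] := pselect (ord_le (Ssup f) (Ssup g)); first by left.
right=> j; apply: contrapT => nji; apply: nab => i.
by exists j; have [//|ba] := IH i (g j); case: nji; exists i.
Qed.

Lemma ord_le_succ a : ord_le a (succ_ord a).
Proof.
elim: a => I f IH i; exists tt.
by apply: ord_le_trans (IH i) _ => -[]; exists i; exact: ord_le_refl.
Qed.

Lemma succ_ord_le a b : ord_le a b -> ord_le (succ_ord a) (succ_ord b).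
Proof. by move=> ab []; exists tt. Qed.

Lemma ord_le_or_lt a b : ord_le a b \/ ord_lt b a.
Proof.
suff [] : (ord_le a b \/ ord_lt b a) /\ (ord_le b a \/ ord_lt a b) by [].
elim: a b => I f IH [J g]; split.
- have [[i gi]|ni] := pselect (exists i, ord_le (Ssup g) (f i)).
    by right=> -[]; exists i.
  left=> i; have [_ [gi|fi]] := IH i (Ssup g); first by case: ni; exists i.
  exact: (fi tt).
- have [[j fj]|nj] := pselect (exists j, ord_le (Ssup f) (g j)).
    by right=> -[]; exists j.
  left=> j; apply: contrapT => ngj; apply: nj; exists j.
  have lt_fg i : ord_lt (f i) (g j).
    by have [_ []] := IH i (g j) => // gf; case: ngj; exists i.
  by case: (g j) lt_fg => K h lt_fg i; have [k] := lt_fg i tt; exists k.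
Qed.

Lemma ord_sup_ub (T : Type) (F : T -> Ord) i : ord_le (F i) (ord_sup F).
Proof.
rewrite /ord_sup; case E : (F i) => [J g] j.
have e : ord_index (F i) = J by rewrite E.
have [j' <-] : exists j' : ord_index (F i), ord_child j' = g j.
  by rewrite E; exists j.
by exists (existT _ i j'); exact: ord_le_refl.
Qed.

Lemma ord_child_lt a (i : ord_index a) : ord_lt (ord_child i) a.
Proof. by case: a i => I f i [] /=; exists i; exact: ord_le_refl. Qed.

End Ordinals.

(** * Derivatives, ranks and the perfect kernel *)

Section Derivatives.
Variable X : topologicalType.
Implicit Types (a b : Ord) (x y : X) (A : set X).

Lemma derived_setP A x :
  derived_set A x <-> A x /\ forall N, nbhs x N -> exists y, [/\ N y, A y & y <> x].
Proof.
split=> [[Ax nix]|[Ax acc]].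
- split=> // N xN; apply: contrapT => nN; apply: nix; split; first exact/mem_set.
  exists N => //; apply/seteqP; split=> [y [Ny Ay]|_ ->].
    by apply: contrapT => yx; apply: nN; exists y.
  by split => //; exact: nbhs_singleton.
- split=> // -[_ [N xN NA]]; have [y [Ny Ay]] := acc N xN; apply.
  by have : (N `&` A) y by []; rewrite NA.
Qed.

Lemma closed_derived_set A : closed A -> closed (derived_set A).
Proof.
move=> cA x clx.
have Ax : A x.
  by apply: cA; apply: closureS clx => y [].
apply/derived_setP; split => // N xN.
have [M [oM Mx MN]] : exists M, [/\ open M, M x & M `<=` N].
  by move: xN; rewrite nbhsE => -[M [oM Mx] MN]; exists M.
have [y [dy My]] := clx M (open_nbhs_nbhs (conj oM Mx)).
have [Ay _] := (derived_setP A y).1 dy.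
have [yx|yx] := pselect (y = x); last by exists y; split => //; exact: MN.
have [_ /(_ M (open_nbhs_nbhs (conj oM My)))[z [Mz Az zy]]] := (derived_setP A y).1 dy.
by exists z; split => //; [exact: MN|rewrite -yx].
Qed.

Lemma CB_succE a : CB_derivative X (succ_ord a) = derived_set (CB_derivative X a).
Proof. by apply/seteqP; split=> [x /(_ tt Logic.I)|x dx []]. Qed.

Lemma CB_closed a : closed (CB_derivative X a).
Proof. by elim: a => I f IH /=; apply: closed_bigI => i _; exact: closed_derived_set. Qed.

Lemma CB_nested a b :
  CB_derivative X a `<=` CB_derivative X b \/ CB_derivative X b `<=` CB_derivative X a.
Proof.
by have [/CB_derivative_anti|/CB_derivative_anti] := ord_le_total a b; [right|left].
Qed.

Lemma CB_succ_sub a : CB_derivative X (succ_ord a) `<=` CB_derivative X a.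
Proof. exact/CB_derivative_anti/ord_le_succ. Qed.

Lemma has_rank_exists a x : ~ CB_derivative X a x -> exists b, has_rank x b.
Proof.
elim: a => I f IH nfx.
have [i nfi] : exists i, ~ derived_set (CB_derivative X (f i)) x.
  by apply: contrapT => ni; apply: nfx => i _; apply: contrapT => ?; apply: ni; exists i.
have [fi|/IH//] := pselect (CB_derivative X (f i) x).
by exists (f i); split => //; rewrite CB_succE.
Qed.

(** The points outside the kernel can index a tree: choose for each an ordinal at which it is lost,
    and take the least ordinal above all of these. *)
Lemma kernel_stage :
  exists a, forall x, CB_derivative X a x -> forall b, CB_derivative X b x.
Proof.
pose T := {x : X | exists b, ~ CB_derivative X b x}.
exists (Ssup (fun t : T => projT1 (cid (projT2 t)))) => x ax b.
apply: contrapT => nbx; pose t : T := exist _ x (ex_intro _ b nbx).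
by have [+ _] := ax t Logic.I; exact: (projT2 (cid (projT2 t))).
Qed.

Lemma derived_sub_CB A a : A `<=` derived_set A -> A `<=` CB_derivative X a.
Proof.
move=> dA; elim: a => I f IH x Ax i _; apply/derived_setP; split; first exact: IH.
have [_ acc] := (derived_setP A x).1 (dA _ Ax).
by move=> N /acc[y [Ny Ay yx]]; exists y; split => //; exact: IH.
Qed.

(** The perfect kernel is itself a stage, so it has no isolated point; conversely, a set without
    isolated points survives all derivatives. *)
Lemma scatteredP : scattered X <-> forall x, exists a, ~ CB_derivative X a x.
Proof.
split=> [scX x|kerX A [x Ax]].
- apply: contrapT => nx; have [a aker] := kernel_stage.
  have kx : CB_derivative X a x by apply: contrapT => nax; apply: nx; exists a.
  have [y iy] := scX (CB_derivative X a) (ex_intro _ x kx).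
  have ay : CB_derivative X a y by case: iy => /set_mem.
  by have := aker y ay (succ_ord a); rewrite CB_succE => -[].
- apply: contrapT => nA; have [a nax] := kerX x; apply: nax.
  apply: (derived_sub_CB (A := A)) => // y Ay; split => // iy.
  by apply: nA; exists y.
Qed.

Lemma rank_spec x : (exists a, ~ CB_derivative X a x) -> has_rank x (rank x).
Proof.
move=> [a /has_rank_exists xr]; rewrite /rank.
by case: pselect => // h; case: cid.
Qed.

End Derivatives.

(** * Comparison of ranks and pieces with a peak *)

Section RankOrder.
Variable X : topologicalType.
Implicit Types (a b : Ord) (x y z : X) (A D : set X).

(* A point of the perfect kernel counts as having rank infinity, and
   [rank_lt] is reflexive exactly there. *)
Definition rank_le x y := forall a, CB_derivative X a x -> CB_derivative X a y.

Definition rank_lt x y :=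
  forall a, CB_derivative X a x -> CB_derivative X (succ_ord a) y.

Lemma rank_le_refl x : rank_le x x.
Proof. by []. Qed.

Lemma rank_le_trans y x z : rank_le x y -> rank_le y z -> rank_le x z.
Proof. by move=> xy yz a /xy /yz. Qed.

Lemma rank_ltW x y : rank_lt x y -> rank_le x y.
Proof. by move=> xy a /xy /CB_succ_sub. Qed.

Lemma rank_lt_le_trans y x z : rank_lt x y -> rank_le y z -> rank_lt x z.
Proof. by move=> xy yz a /xy /yz. Qed.

Lemma rank_le_lt_trans y x z : rank_le x y -> rank_lt y z -> rank_lt x z.
Proof. by move=> xy yz a /xy /yz. Qed.

Lemma rank_nle_lt x y : ~ rank_le y x -> rank_lt x y.
Proof.
move=> /existsNP[a /not_implyP[ya nxa]] b xb.
have [/CB_derivative_anti ab|ba] := ord_le_or_lt a b; first by case: nxa; exact: ab.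
exact: CB_derivative_anti ba _ ya.
Qed.

Lemma rank_nle_nbhs x y : ~ rank_le x y ->
  exists2 N, nbhs y N & forall z, N z -> ~ rank_le x z.
Proof.
move=> /existsNP[a /not_implyP[xa nya]]; exists (~` CB_derivative X a).
  by apply: open_nbhs_nbhs; split => //; exact/closed_openC/CB_closed.
by move=> z nza xz; apply: nza; exact: xz.
Qed.

(** A point of rank [b] is isolated in stage [b], so its neighbours are lost by then. At a point of
    the kernel any neighbourhood will do, infinity being allowed to exceed itself. *)
Lemma rank_lt_nbhs y : exists2 N, nbhs y N & forall x, N x -> x <> y -> rank_lt x y.
Proof.
have [kery|] := pselect (forall a, CB_derivative X a y).
  by exists setT; [exact: filterT|move=> x _ _ a _; exact: kery].
move=> /existsNP[a /has_rank_exists[b [yb]]]; rewrite CB_succE => ny.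
have [N yN NP] : exists2 N, nbhs y N & forall x, N x -> x <> y -> ~ CB_derivative X b x.
  apply: contrapT => nN; apply: ny; apply/derived_setP; split => // N yN.
  apply: contrapT => nz; apply: nN; exists N => // x Nx xy xb.
  by apply: nz; exists x.
exists N => // x Nx xy c xc; have [bc|cb] := ord_le_or_lt b c.
  by case: (NP x Nx xy); exact: CB_derivative_anti bc _ xc.
exact: CB_derivative_anti cb _ yb.
Qed.

(** If [x] has rank [b], then [y] is an accumulation point of stage [b]; if [x] is in the kernel,
    the same argument applies to the stage that equals the kernel. *)
Lemma rank_lt_acc x y : rank_lt x y ->
  forall N, nbhs y N -> exists z, [/\ N z, z <> y & rank_le x z].
Proof.
move=> xy N yN.
have acc a : CB_derivative X a x -> exists z, [/\ N z, z <> y & CB_derivative X a z].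
  move=> /xy; rewrite CB_succE => /derived_setP[_ /(_ N yN)[z [Nz az zy]]].
  by exists z.
have [kerx|] := pselect (forall a, CB_derivative X a x).
  have [a aker] := kernel_stage X.
  have [z [Nz zy az]] := acc a (kerx a).
  by exists z; split => // b _; exact: aker.
move=> /existsNP[a /has_rank_exists[b [xb nxb]]].
have [z [Nz zy bz]] := acc b xb; exists z; split => // c xc.
have [cb|bc] := ord_le_or_lt c b; first exact: CB_derivative_anti cb _ bz.
by case: nxb; exact: CB_derivative_anti bc _ xc.
Qed.

(** Without a maximum, every point of [D] has a neighbourhood all of whose points rank below one
    fixed point of [D]. Finitely many of these fixed points have a largest, as ranks are totally
    ordered, and it would rank below itself. *)
Lemma rank_max D : compact D -> D !=set0 ->
  exists2 t, D t & forall x, D x -> rank_le x t.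
Proof.
move=> cD [x0 Dx0]; apply: contrapT => nmax.
pose Q S := exists2 x, D x & forall z, S z -> ~ rank_le x z.
suff [x Dx /(_ x Dx)] : Q D by apply.
apply: compact_induction => //.
- by exists x0.
- by move=> A A' AA' [x Dx xA']; exists x => // z /AA'; exact: xA'.
- move=> A A' [x Dx xA] [y Dy yA'].
  have [xy|/rank_nle_lt/rank_ltW yx] := pselect (rank_le x y).
    exists y => // z [/xA nxz yz|/yA'//]; apply: nxz; exact: rank_le_trans xy yz.
  exists x => // z [/xA//|/yA' nyz xz]; apply: nyz; exact: rank_le_trans yx xz.
- move=> t Dt.
  have [x Dx nxt] : exists2 x, D x & ~ rank_le x t.
    apply: contrapT => nx; apply: nmax; exists t => // x Dx.
    by apply: contrapT => nxt; apply: nx; exists x.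
  have [N tN NP] := rank_nle_nbhs nxt.
  by exists N => //; exists x => // z [_ /NP].
Qed.

End RankOrder.

(** * Finite partitions of clopen sets into pieces with a peak *)

Section Peaks.
Variable X : topologicalType.
Implicit Types (x y z t : X) (A D : set X).

Lemma clopenD A D : clopen A -> clopen D -> clopen (A `\` D).
Proof. by move=> cA cD; rewrite setDE; apply: clopenI => //; exact: (clopenC set0). Qed.

Definition peak A q := [/\ clopen A, A q & forall x, A x -> x <> q -> rank_lt x q].

Definition clopen_base (B : nat -> set X) :=
  [/\ forall n, clopen (B n),
      forall x N, nbhs x N -> exists2 n, B n x & B n `<=` N
    & forall x y, x <> y -> exists2 n, B n x & ~ B n y].

(** Pieces may be empty, and then [t i] is arbitrary; so a finite partition can be padded to one
    indexed by [nat]. *)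
Definition peak_partition (I : Type) D (C : I -> set X) (t : I -> X) :=
  [/\ forall i, clopen (C i), forall i j x, C i x -> C j x -> i = j,
      forall x, D x <-> exists i, C i x
    & forall i, C i !=set0 -> peak (C i) (t i)].

Variable B : nat -> set X.
Hypothesis baseB : clopen_base B.
Hypothesis compactX : compact [set: X].

(** The list [l] consists of the points of maximal rank. They are split off one at a time by basic
    clopen sets, and a piece containing just one of them has it as its peak. *)
Lemma peak_partition_seq (l : seq X) D t0 : uniq l -> clopen D ->
  l != [::] ->
  (forall x, x \in l <-> D x /\ rank_le t0 x) ->
  (forall x, D x -> rank_le x t0) ->
  exists (C : nat -> set X) (t : nat -> X), peak_partition D C t /\
    forall i, if (i < size l)%N then C i !=set0 /\ rank_le t0 (t i) else C i = set0.
Proof.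
have [cB baseB1 baseB2] := baseB.
elim: l D => // y l IH D ul cD _ lD Dt0.
have [Dy t0y] : D y /\ rank_le t0 y by apply/lD; rewrite mem_head.
have peakD C : clopen C -> C y -> C `<=` D -> (forall z, C z -> z \notin l) ->
    peak C y.
  move=> cC Cy CD Cl; split => // x Cx xy; apply: rank_lt_le_trans t0y.
  apply: rank_nle_lt => t0x.
  have : x \in y :: l by apply/lD; split => //; exact: CD.
  by rewrite inE => /orP[/eqP//|xl]; move: (Cl _ Cx); rewrite xl.
have [l0|l0] := eqVneq l [::].
  rewrite {}l0 in peakD *.
  exists (fun i => if i is 0%N then D else set0), (fun=> y); split; last first.
    by case=> //=; split => //; exists y.
  split.
  - by case=> // _; exact: clopen0.
  - by move=> [|i] [|j].
  - by move=> x; split=> [Dx|[[|i]]] //=; exists 0%N.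
  - by move=> [|i] // [z] //= _; apply: peakD.
have /= /andP[yl ull] := ul.
have [n Bny Bnl] : exists2 n, B n y & forall z, B n z -> z \notin l.
  have : exists2 N, nbhs y N & forall z, N z -> z \notin l.
    elim: (l) yl => [|z l' IHl]; first by exists setT => //; exact: filterT.
    rewrite inE negb_or => /andP[/eqP yz /IHl[N yN Nl']].
    have [n Bny nBnz] := baseB2 _ _ yz.
    exists (N `&` B n).
      by apply: filterI => //; apply: open_nbhs_nbhs; split => //; case: (cB n).
    move=> w [/Nl' wl' Bnw]; rewrite inE negb_or wl' andbT.
    by apply/eqP => wz; apply: nBnz; rewrite -wz.
  by move=> [N yN Nl]; have [n Bny BN] := baseB1 _ _ yN; exists n => // z /BN /Nl.
have [||C [t [[cC dC eC pC] sC]]] := IH (D `\` B n) ull (clopenD cD (cB n)) l0.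
- move=> x; split=> [xl|[[Dx nBx] t0x]].
    have [Dx t0x] : D x /\ rank_le t0 x by apply/lD; rewrite inE xl orbT.
    by split => //; split => // /Bnl; rewrite xl.
  have : x \in y :: l by apply/lD.
  by rewrite inE => /orP[/eqP xy|//]; case: nBx; rewrite xy.
- by move=> x [Dx _]; exact: Dt0.
exists (fun i => if i is i'.+1 then C i' else D `&` B n).
exists (fun i => if i is i'.+1 then t i' else y); split; last first.
  by case=> [|i] /=; [split => //; exists y|exact: sC].
split.
- by case=> [|i]; [exact: clopenI|exact: cC].
- move=> [|i] [|j] //= x.
  + by move=> [_ Bx] Cx; have [_] := (eC x).2 (ex_intro _ j Cx).
  + by move=> Cx [_ Bx]; have [_] := (eC x).2 (ex_intro _ i Cx).
  + by move=> Ci Cj; rewrite (dC i j x).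
- move=> x; split=> [Dx|[[|i] Cx]].
  + have [Bx|nBx] := pselect (B n x); first by exists 0%N.
    by have [i Cx] := (eC x).1 (conj Dx nBx); exists i.+1.
  + by case: Cx.
  + by have [] := (eC x).2 (ex_intro _ i Cx).
- move=> [|i] /= Ci0; last exact: pC.
  by apply: peakD; [exact: clopenI|split|move=> x []|move=> x [_ /Bnl]].
Qed.

(** If the maximal rank is not infinity, the points attaining it form a closed discrete set, which
    compactness makes finite. *)
Lemma clopen_peak_partition (x0 : X) D : clopen D ->
  exists k (C : nat -> set X) (t : nat -> X), peak_partition D C t /\
    forall i, if (i < k)%N then
      C i !=set0 /\ (forall x, D x -> rank_le x (t i)) else C i = set0.
Proof.
move=> cD; have [cB baseB1 baseB2] := baseB.
have [D0|/set0P Dn0] := eqVneq D set0.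
  exists 0%N, (fun=> set0), (fun=> x0); split => //; split=> //.
  - by move=> _; exact: clopen0.
  - by rewrite D0 => x; split=> // -[].
  - by move=> _ [].
have compD : compact D by apply: closed_compact_space => //; case: cD.
have [t0 Dt0 maxt0] := rank_max compD Dn0.
(* [rank_lt t0 t0] says that [t0] lies in the perfect kernel; then [D] is a single piece with peak
   [t0]. *)
have [t00|nt00] := pselect (rank_lt t0 t0).
  exists 1%N, (fun i => if i is 0%N then D else set0), (fun=> t0); split; last first.
    by case.
  split.
  - by case=> // _; exact: clopen0.
  - by move=> [|i] [|j].
  - by move=> x; split=> [Dx|[[|i]]] //=; exists 0%N.
  - move=> [|i] [z] //= _; split=> // x Dx _.
    exact: rank_le_lt_trans (maxt0 _ Dx) t00.
pose M := [set x | D x /\ rank_le t0 x].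
have closedM : closed M.
  move=> x clx; split.
    by have [_] := cD; apply; apply: closureS clx => y [].
  apply: contrapT => /rank_nle_nbhs[N /clx[y [[_ t0y] Ny]] /(_ y Ny)].
  exact.
have /finite_seqP[l Ml] : finite_set M.
  apply: closed_discrete_finite; first exact: closed_compact_space.
  move=> x [Dx t0x]; have [N xN Nlt] := rank_lt_nbhs x.
  exists N => // y [[Dy t0y] Ny]; apply: contrapT => yx; apply: nt00.
  exact: rank_le_lt_trans t0y (rank_lt_le_trans (Nlt y Ny yx) (maxt0 _ Dx)).
have memM x : x \in undup l <-> D x /\ rank_le t0 x.
  rewrite mem_undup; split=> [xl|Mx]; first by have : M x by rewrite Ml.
  by have : M x := Mx; rewrite Ml.
have l0 : undup l != [::].
  apply/eqP => l0; have /memM : D t0 /\ rank_le t0 t0 by split => // a.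
  by rewrite l0.
have [C [t [pC sC]]] := peak_partition_seq (undup_uniq l) cD l0 memM maxt0.
exists (size (undup l)), C, t; split => // i; have := sC i.
case: ifP => // _ [? t0t]; split=> // x Dx; exact: rank_le_trans (maxt0 _ Dx) t0t.
Qed.

End Peaks.

(** * Infinite partitions of a piece without its peak *)

Section Partitions.
Variable X : topologicalType.
Implicit Types (x y z t q : X) (A D E : set X) (C : nat -> set X).

Lemma clopen_bigcup_lt C m : (forall i, clopen (C i)) ->
  clopen (\bigcup_(i < m) C i).
Proof.
move=> cC; split; first by apply: bigcup_open => i _; case: (cC i).
by apply: closed_bigcup => [|i _]; [exact: finite_II|case: (cC i)].
Qed.

Lemma least_index C x : (exists i, C i x) ->
  exists2 i, C i x & ~ (\bigcup_(j < i) C j) x.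
Proof.
move=> Cx; have ex : exists i, `[< C i x >] by case: Cx => i Ci; exists i; exact/asboolP.
exists (ex_minn ex); first by case: ex_minnP => i /asboolP.
case: ex_minnP => i _ mini [j /= ji Cj].
by have := mini j; rewrite leqNgt ji => /(_ (asboolT Cj)).
Qed.

Lemma increasing_choice (fits : nat -> nat -> Prop) :
  (forall j N, exists2 n, (N <= n)%N & fits j n) ->
  exists2 e : nat -> nat, injective e & forall j, fits j (e j).
Proof.
move=> fitsP.
have /choice[g gP] : forall p : nat * nat, exists n, (p.2 <= n)%N /\ fits p.1 n.
  by move=> [j N]; have [n ? ?] := fitsP j N; exists n.
pose e := fix e j := if j is i.+1 then g (i.+1, (e i).+1) else g (0, 0)%N.
have incr : {homo e : i j / (i < j)%N}.
  by apply: homo_ltn => [|i]; [exact: ltn_trans|case: (gP (i.+1, (e i).+1))].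
exists e; last by case=> [|j]; [case: (gP (0, 0)%N)|case: (gP (j.+1, (e j).+1))].
by move=> i j eij; case: (ltngtP i j) => // /incr; rewrite eij ltnn.
Qed.

Variable B : nat -> set X.
Hypothesis baseB : clopen_base B.
Hypothesis compactX : compact [set: X].

Lemma closed_point q : closed [set q].
Proof.
have [cB _ sepB] := baseB.
move=> x clx; apply: contrapT => /= xq; have [n Bx nBq] := sepB _ _ xq.
by have [|y [-> //]] := clx (B n); apply: open_nbhs_nbhs; split => //; case: (cB n).
Qed.

(** The basic sets that lie in [D] and on one side of [E] cover [D]; subtracting the earlier ones
    makes them disjoint. *)
Lemma open_clopen_partition D E : open D -> clopen E ->
  exists C, [/\ forall i, clopen (C i), forall i j x, C i x -> C j x -> i = j,
    forall x, D x <-> exists i, C i x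
  & forall i, C i `<=` E \/ C i `<=` ~` E].
Proof.
move=> oD cE; have [cB baseB1 _] := baseB.
pose G i := [set x | B i x /\ (B i `<=` D /\ (B i `<=` E \/ B i `<=` ~` E))].
have cG i : clopen (G i).
  have [ok|nok] := pselect (B i `<=` D /\ (B i `<=` E \/ B i `<=` ~` E)).
    by rewrite (_ : G i = B i) //; apply/seteqP; split => x // [].
  by rewrite (_ : G i = set0); [exact: clopen0|apply/seteqP; split => x // []].
exists (fun i => G i `\` \bigcup_(j < i) G j); split.
- by move=> i; apply: clopenD => //; exact: clopen_bigcup_lt.
- move=> i j x [Gi nGi] [Gj nGj]; case: (ltngtP i j) => // ij.
    by case: nGj; exists i.
  by case: nGi; exists j.
- move=> x; split=> [Dx|[i [[Bi [BD _]] _]]]; last exact: BD.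
  suff /least_index[i Gi nG] : exists i, G i x by exists i.
  have [F [oF Fx FD]] : exists F, [/\ open F, F x & F `<=` D /\ (F `<=` E \/ F `<=` ~` E)].
    have [Ex|nEx] := pselect (E x).
      exists (D `&` E); split; [by apply: openI => //; case: cE|by []|].
      by split=> [y []//|]; left => y [].
    exists (D `&` ~` E); split; [|by []|].
      by apply: openI => //; case: (clopenC set0 cE).
    by split=> [y []//|]; right => y [].
  have [i Bi BF] := baseB1 x F (open_nbhs_nbhs (conj oF Fx)).
  exists i; split => //; case: FD => FD FE; split; first exact: subset_trans FD.
  by case: FE => FE; [left|right]; exact: subset_trans FE.
- by move=> i; have [[|]|] := pselect (B i `<=` E \/ B i `<=` ~` E) => [BE|BE|nBE];
     [left|right|left]; move=> x [[Bx [_ /= H]] _] //; exact: BE.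
Qed.

Lemma punctured_peak_partition A q E : peak A q -> clopen E ->
  exists (C : nat * nat -> set X) (t : nat * nat -> X),
    peak_partition (A `\ q) C t /\ forall p, C p `<=` E \/ C p `<=` ~` E.
Proof.
move=> [[oA _] Aq _] cE.
have oAq : open (A `\ q) by rewrite setDE; apply: openI => //; exact/closed_openC/closed_point.
have [D [cD dD eD DE]] := open_clopen_partition oAq cE.
have /choice[Ct CtP] : forall m, exists Ct : (nat -> set X) * (nat -> X),
    peak_partition (D m) Ct.1 Ct.2.
  move=> m; have [k [C [t [pC _]]]] := clopen_peak_partition baseB compactX q (cD m).
  by exists (C, t).
exists (fun p => (Ct p.1).1 p.2), (fun p => (Ct p.1).2 p.2); split; first split.
- by move=> [m i]; have [+ _ _ _] := CtP m; apply.
- move=> [m i] [m' i'] x /= Cm Cm'.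
  have [_ dm em _] := CtP m; have [_ _ em' _] := CtP m'.
  have mm' : m = m'.
    by apply: (dD _ _ x); [apply/em; exists i|apply/em'; exists i'].
  by rewrite -mm' in Cm' *; rewrite (dm _ _ _ Cm Cm').
- move=> x; split=> [/eD[m Dm]|[[m i] Cx]].
    by have [_ _ em _] := CtP m; have [i Ci] := (em x).1 Dm; exists (m, i).
  by apply/eD; exists m; have [_ _ em _] := CtP m; apply/em; exists i.
- by move=> [m i]; have [_ _ _] := CtP m; apply.
- move=> [m i]; have [_ _ em _] := CtP m.
  have CD : (Ct m).1 i `<=` D m by move=> x Cx; apply/em; exists i.
  by case: (DE m) => H; [left|right]; exact: subset_trans H.
Qed.

(** Removing the first [N] pieces leaves a neighbourhood of [q], in which points of rank at least
    that of [x] accumulate at [q]; the peak of the piece of such a point ranks at least as high. *)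
Lemma peak_partition_cofinal A q C (t : nat -> X) x N :
  peak A q -> peak_partition (A `\ q) C t -> rank_lt x q ->
  exists2 n, (N <= n)%N & C n !=set0 /\ rank_le x (t n).
Proof.
move=> [[oA cA] Aq _] [cC dC eC pC] xq.
have qC n : ~ C n q.
  by move=> Cq; have [_ /(_ erefl)] := (eC q).2 (ex_intro _ n Cq).
have nV : nbhs q (A `\` \bigcup_(i < N) C i).
  apply: open_nbhs_nbhs; split; last by split => // -[i _ /qC].
  by have [] := clopenD (conj oA cA) (clopen_bigcup_lt N cC).
have [z [[Az nCz] zq xz]] := rank_lt_acc xq nV.
have [n Cn] := (eC z).1 (conj Az zq).
exists n; first by rewrite leqNgt; apply/negP => nN; apply: nCz; exists n.
have Cn0 : C n !=set0 by exists z.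
split => //; have [_ _ lt_t] := pC n Cn0; apply: rank_le_trans xz _.
have [->|zt] := pselect (z = t n); first exact: rank_le_refl.
exact/rank_ltW/lt_t.
Qed.

(* A piece with a peak, or [(set0, _)] for an absent piece. *)
Implicit Types (u v : set X * X) (k l : nat -> set X * X).

Definition children u k :=
  peak_partition (u.1 `\ u.2) (fun n => (k n).1) (fun n => (k n).2).

Definition dominated u v := u.1 !=set0 -> v.1 !=set0 /\ rank_le u.2 v.2.

Definition valid u := u.1 !=set0 -> peak u.1 u.2.

(** The pieces of [u] come in no particular order. Their peaks rank below [v.2], so each can be sent
    to its own slot [n] at which [l n] ranks high enough; all other slots receive the empty
    piece. *)
Lemma dominated_children u v l E : valid u -> valid v -> dominated u v ->
  children v l -> clopen E ->
  exists k, [/\ children u k, forall n, dominated (k n) (l n)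
    & forall n, (k n).1 `<=` E \/ (k n).1 `<=` ~` E].
Proof.
move=> vu vv uv chl cE.
have [u0|/set0P u0] := eqVneq u.1 set0.
  exists (fun=> (set0, u.2)); split=> [||n]; [|by move=> n []|by left].
  split=> //=; [by move=> _; exact: clopen0| |by move=> _ []].
  by rewrite u0 => x; split=> [[]|[]].
have {uv}[v0 uv] := uv u0; have {vv}pv := vv v0; have {vu}pu := vu u0.
have [C [t [[cC dC eC pC] CE]]] := punctured_peak_partition pu cE.
(* Pairs are numbered by [pickle]; numbers that code no pair, or the pair of an empty piece, fit
   into every slot. *)
pose fits j n := if @pickle_inv (nat * nat)%type j is Some p then
  C p !=set0 -> (l n).1 !=set0 /\ rank_le (t p) (l n).2 else True.
have [|e inje fitse] := @increasing_choice fits.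
  move=> j N; rewrite /fits; case: pickle_inv => [p|]; last by exists N.
  have [Cp|nCp] := pselect (C p !=set0); last by exists N.
  have tu : rank_lt (t p) u.2.
    have [_ _ +] := pu; have [_ Ct _] := pC p Cp.
    by have [Au tu] := (eC (t p)).2 (ex_intro _ p Ct) => /(_ _ Au tu).
  have [n Nn ln] := peak_partition_cofinal N pv chl (rank_lt_le_trans tu uv).
  by exists n.
have fitsp p : C p !=set0 -> (l (e (pickle p))).1 !=set0 /\ rank_le (t p) (l (e (pickle p))).2.
  by have := fitse (pickle p); rewrite /fits pickleK_inv.
pose k n := if pselect (exists p : nat * nat, e (pickle p) = n) is left h then
  let p := projT1 (cid h) in (C p, t p) else (set0, u.2).
have kE p : k (e (pickle p)) = (C p, t p).
  rewrite /k; case: pselect => [h|[]]; last by exists p.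
  by case: cid => p' /= /inje /(pcan_inj pickleK) ->.
have kP n : (exists2 p, n = e (pickle p) & k n = (C p, t p)) \/ k n = (set0, u.2).
  have [[p <-]|nh] := pselect (exists p : nat * nat, e (pickle p) = n); first by left; exists p.
  by right; rewrite /k; case: pselect.
exists k; split; first split.
- by move=> n; case: (kP n) => [[p _ ->]|->]; [exact: cC|exact: clopen0].
- move=> n m x; case: (kP n) => [[p -> ->]|->] //; case: (kP m) => [[p' -> ->]|->] //=.
  by move=> Cp Cp'; rewrite (dC _ _ _ Cp Cp').
- move=> x; split=> [/eC[p Cp]|[n]]; first by exists (e (pickle p)); rewrite kE.
  by case: (kP n) => [[p _ ->]|->] // Cp; apply/eC; exists p.
- by move=> n; case: (kP n) => [[p _ ->]|->]; [exact: pC|move=> [? []]].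
- by move=> n; case: (kP n) => [[p -> ->]|->]; [exact: fitsp|move=> [? []]].
- by move=> n; case: (kP n) => [[p _ ->]|->]; [exact: CE|left].
Qed.

(** Clopen neighbourhoods shrink to the peak so slowly that each successive difference keeps a point
    of rank at least that of [y]. In the partition of a difference all peaks attain its maximal
    rank, so none ranks below [y]. *)
Lemma equal_height_children u y : peak u.1 u.2 -> rank_lt y u.2 ->
  exists2 k, children u k & forall n, (k n).1 !=set0 /\ rank_le y (k n).2.
Proof.
move=> [cu uq ltu] yq; have [cB baseB1 sepB] := baseB; set q := u.2 in yq uq ltu *.
pose nb V := clopen V /\ V q.
(* From stage [m] on the neighbourhoods lie in [B m] if this contains [q], so that they intersect in
   [q] alone; the point [z] is what the shrinking discards. *)
have /choice[next nextP] : forall p : set X * nat, exists V', nb p.1 ->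
    [/\ nb V', V' `<=` p.1, B p.2 q -> V' `<=` B p.2
      & exists2 z, (p.1 `\` V') z & rank_le y z].
  move=> [V m]; have [[cV Vq]|] := pselect (nb V); last by exists set0.
  have nV : nbhs q V by apply: open_nbhs_nbhs; split => //; case: cV.
  have [z [Vz zq yz]] := rank_lt_acc yq nV.
  have [j Bj nBj] := sepB _ _ (nesym zq).
  pose W := if pselect (B m q) then B m else setT.
  have [cW Wq] : nb W.
    by rewrite /W; case: pselect => Bq; split => //; [exact: cB|exact: clopenT].
  exists (V `&` W `&` B j) => _; split.
  - by split=> //; apply: clopenI => //; exact: clopenI.
  - by move=> x [[]].
  - by move=> Bq x [[_ +] _]; rewrite /W; case: pselect.
  - by exists z => //; split => // -[_].
pose V := fix V m := if m is m'.+1 then next (V m', m') else u.1.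
have nbV m : nb (V m) by elim: m => //= m /(nextP (V m, m))[].
have VS m : V m.+1 `<=` V m by have [] := nextP (V m, m) (nbV m).
have Vle m n : (m <= n)%N -> V n `<=` V m.
  elim: n => [|n IH]; first by rewrite leqn0 => /eqP->.
  by rewrite leq_eqVlt => /orP[/eqP->//|/IH H] x /VS /H.
have Vq x : (forall m, V m x) -> x = q.
  move=> Vx; apply: contrapT => /nesym /sepB[m Bq nBx].
  by have [_ _ /(_ Bq) VB _] := nextP (V m, m) (nbV m); exact/nBx/VB/(Vx m.+1).
pose D m := V m `\` V m.+1.
have cD m : clopen (D m) by apply: clopenD; [case: (nbV m)|case: (nbV m.+1)].
have dD m m' x : D m x -> D m' x -> m = m'.
  move=> [Vm nVm] [Vm' nVm']; case: (ltngtP m m') => // lt.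
    by case: nVm; exact: Vle lt _ Vm'.
  by case: nVm'; exact: Vle lt _ Vm.
have eD x : (u.1 `\ q) x <-> exists m, D m x.
  split=> [[ux xq]|[m [Vx nVx]]]; last first.
    split; first exact: (Vle 0%N m).
    by move=> /= xq; apply: nVx; rewrite xq; case: (nbV m.+1).
  have [m nVm] : exists m, ~ V m x by apply: contrapT => nm; apply: xq; apply: Vq => m;
    apply: contrapT => nVm; apply: nm; exists m.
  elim: m nVm => [//|m IH nVm]; have [Vm|/IH//] := pselect (V m x).
  by exists m.
have /choice[r rP] : forall m, exists r : nat * ((nat -> set X) * (nat -> X)),
    peak_partition (D m) r.2.1 r.2.2 /\ forall i, if (i < r.1)%N then
      r.2.1 i !=set0 /\ (forall x, D m x -> rank_le x (r.2.2 i)) else r.2.1 i = set0.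
  move=> m; have [k [C [t H]]] := clopen_peak_partition baseB compactX q (cD m).
  by exists (k, (C, t)).
have r0 m : (0 < (r m).1)%N.
  rewrite lt0n; apply/negP => /eqP rm; have [[_ _ em _] sm] := rP m.
  have [z Dz _] : exists2 z, D m z & rank_le y z by have [] := nextP (V m, m) (nbV m).
  by have [i] := (em z).1 Dz; have := sm i; rewrite rm ltn0 => ->.
(* These are the indices of the nonempty pieces. There are infinitely many, as every difference
   contributes one, so [nat] enumerates them bijectively and no slot stays empty. *)
pose S := [set p : nat * nat | (p.2 < (r p.1).1)%N].
have /card_esym/card_set_bijP[e [eS inje surje]] : (S #= [set: nat])%card.
  apply: eq_card_nat; first exact: countableP.
  move=> /(finite_image fst) finS; apply: infinite_nat.
  by apply: sub_finite_set finS => m _; exists (m, 0%N) => //; exact: r0.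
exists (fun n => ((r (e n).1).2.1 (e n).2, (r (e n).1).2.2 (e n).2)); first split.
- by move=> n /=; have [[+ _ _ _] _] := rP (e n).1; apply.
- move=> n m x /= Cn Cm; apply: inje; rewrite ?inE//.
  have [[_ dn en _] _] := rP (e n).1; have [[_ _ em _] _] := rP (e m).1.
  have e1 : (e n).1 = (e m).1.
    by apply: (dD _ _ x); [apply/en|apply/em]; eexists; eassumption.
  move: Cm; rewrite -e1 => /(dn _ _ _ Cn).
  by move: e1; case: (e n) (e m) => [? ?] [? ?] /= -> ->.
- move=> x; split=> [/eD[m Dm]|[n Cn]]; last first.
    by apply/eD; exists (e n).1; have [[_ _ en _] _] := rP (e n).1; apply/en; exists (e n).2.
  have [[_ _ em _] sm] := rP m; have [i Ci] := (em x).1 Dm.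
  have [n _ en] : exists2 n, True & e n = (m, i).
    have /surje[n _ en] : S (m, i); last by exists n.
    by rewrite /S /=; have := sm i; case: ifP => // _ C0; rewrite C0 in Ci.
  by exists n; rewrite en.
- by move=> n /=; have [[_ _ _ +] _] := rP (e n).1; apply.
- move=> n /=; have [[_ _ em _] sm] := rP (e n).1.
  have := sm (e n).2; rewrite (eS n Logic.I : S (e n)) => -[Cn le_t]; split => //.
  have [z Dz yz] : exists2 z, D (e n).1 z & rank_le y z.
    by have [] := nextP (V (e n).1, (e n).1) (nbV _).
  exact: rank_le_trans yz (le_t z Dz).
Qed.

End Partitions.

(** * The tree of pieces *)

(* [U b] is the set of points whose itinerary starts with [b]; the last clause
   says that the set of all itineraries is invariant under the shift. *)
Definition shift_scheme (X : topologicalType) (L : Type) (A : set X)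
    (U : seq L -> set X) :=
  [/\ U [::] = A, forall b, clopen (U b),
      (forall b x, U b x <-> exists l, U (rcons b l) x) /\
      (forall b l m x, U (rcons b l) x -> U (rcons b m) x -> l = m),
      forall x y, A x -> A y -> (forall b, U b x -> U b y) -> x = y
    & forall l b, U (l :: b) !=set0 -> U b !=set0].

Section Tree.
Variable X : topologicalType.
Variable B : nat -> set X.
Hypothesis baseB : clopen_base B.
Hypothesis compactX : compact [set: X].

Variables (u0 : set X * X) (k0 : nat -> set X * X).
Hypothesis peak_u0 : peak u0.1 u0.2.
Hypothesis children_k0 : children u0 k0.
Hypothesis dominated_k00 : dominated (k0 0%N) u0.
Hypothesis dominated_k0S : forall n, dominated (k0 n.+1) (k0 n).

Definition refinement (u : set X * X) (l : nat -> set X * X) (E : set X) k :=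
  [/\ children u k, forall n, dominated (k n) (l n)
    & forall n, (k n).1 `<=` E \/ (k n).1 `<=` ~` E].

(** The arbitrary default [l] makes this total, so that the tree can be defined before its
    invariants are known. *)
Definition refine (u : set X * X) (l : nat -> set X * X) (E : set X) :=
  if pselect (exists k, refinement u l E k) is left h then projT1 (cid h) else l.

Lemma refineP u l E k : refinement u l E k -> refinement u l E (refine u l E).
Proof.
move=> ek; rewrite /refine; case: pselect => [h|[]]; last by exists k.
exact: (projT2 (cid h)).
Qed.

(* A node of the tree is addressed by the word [v] of the indices of the
   children leading to it, last index first.  Coding the index [n] by the
   binary word [0^n 1], [pred_word] removes the first letter of the code. *)
Fixpoint pred_word (v : seq nat) : seq nat :=
  match v with
  | [::] => [::]
  | [:: 0%N] => [::]
  | [:: n.+1] => [:: n]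
  | n :: v' => n :: pred_word v'
  end.

(** The length of the binary code of [v]. *)
Definition weight (v : seq nat) := sumn (map succn v).

Lemma weight_pred_word n v : (weight (pred_word (n :: v))).+1 = weight (n :: v).
Proof.
elim: v n => [|m v IH] n; first by case: n => [|n]; rewrite /weight //= !addn0.
have -> : pred_word [:: n, m & v] = n :: pred_word (m :: v) by case: n.
by rewrite -[weight (n :: _)]/(n.+1 + weight (pred_word (m :: v)))%N -addnS IH.
Qed.

(** The children of a node are numbered against those of its predecessor, and are cut along
    [B (size v')] to make deep nodes separate points. Since [pred_word v] is not a subterm of [v],
    the recursion runs on fuel [f], for which the weight suffices. *)
Fixpoint kids_upto (f : nat) (v : seq nat) : nat -> set X * X :=
  match f, v with
  | f'.+1, n :: v' =>
      refine (kids_upto f' v' n) (kids_upto f' (pred_word v)) (B (size v'))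
  | _, _ => k0
  end.

Lemma kids_uptoS f n v : kids_upto f.+1 (n :: v) =
  refine (kids_upto f v n) (kids_upto f (pred_word (n :: v))) (B (size v)).
Proof. by []. Qed.

Lemma kids_upto_eq f g v : (weight v <= f)%N -> (weight v <= g)%N ->
  kids_upto f v = kids_upto g v.
Proof.
elim: f g v => [|f IH] g [|n v]; first by case: g.
- by rewrite -weight_pred_word.
- by case: g.
case: g => [|g]; rewrite -weight_pred_word // !ltnS => wf wg.
have wv : (weight v <= weight (pred_word (n :: v)))%N.
  by rewrite -ltnS weight_pred_word /weight /= -addn1 addnC leq_add2r.
by rewrite !kids_uptoS !(IH g) //; exact: leq_trans wv _.
Qed.

Definition kids v := kids_upto (weight v) v.

Definition node v := if v is n :: v' then kids v' n else u0.

Lemma kids_cons n v :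
  kids (n :: v) = refine (kids v n) (kids (pred_word (n :: v))) (B (size v)).
Proof.
have wv : (weight v <= weight (pred_word (n :: v)))%N.
  by rewrite -ltnS weight_pred_word /weight /= -addn1 addnC leq_add2r.
by rewrite {1}/kids -weight_pred_word kids_uptoS (kids_upto_eq wv (leqnn _)).
Qed.

(** Induction on the weight, which is smaller at both the parent and the predecessor. A node is
    dominated by its predecessor because the parent was refined against the predecessor of the
    parent; below the root this is instead the assumption on [k0]. *)
Lemma nodeP v : [/\ valid (node v), children (node v) (kids v)
  & if v is n :: v' then
      dominated (node v) (node (pred_word v)) /\
      refinement (node v) (kids (pred_word v)) (B (size v')) (kids v)
    else True].
Proof.
have nodenil : valid (node [::]) by [].
move: {2}(weight v) (leqnn (weight v)) => w.
elim: w v => [|w IH] [|n v] // wv.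
have wv' : (weight v < weight (n :: v))%N by rewrite /weight /= -addn1 addnC leq_add2r.
have [vv cv pv] : [/\ valid (node v), children (node v) (kids v)
  & if v is m :: v' then
      dominated (node v) (node (pred_word v)) /\
      refinement (node v) (kids (pred_word v)) (B (size v')) (kids v)
    else True] by apply: IH; rewrite -ltnS; exact: leq_trans wv.
have [vp cp _] := IH (pred_word (n :: v)) ltac:(by rewrite -ltnS weight_pred_word).
have vn : valid (node (n :: v)) by have [_ _ _] := cv; apply.
have dn : dominated (node (n :: v)) (node (pred_word (n :: v))).
  case: v {wv wv' vv vp cp vn} pv cv => [|m v] pv cv.
    by rewrite /node /kids /=; case: n => [|n] //=.
  have -> : pred_word [:: n, m & v] = n :: pred_word (m :: v) by case: n.
  by case: pv => _ [_ + _]; apply.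
have [cB _ _] := baseB.
have [k kP] := dominated_children baseB compactX vn vp dn cp (cB (size v)).
have := refineP kP; rewrite -[refine _ _ _]kids_cons => kidsP.
by split => //; case: kidsP.
Qed.

Lemma children_node v : children (node v) (kids v).
Proof. by case: (nodeP v). Qed.

Lemma dominated_pred_word n v :
  dominated (node (n :: v)) (node (pred_word (n :: v))).
Proof. by case: (nodeP (n :: v)) => _ _ []. Qed.

Lemma node_decided m n v :
  (node [:: m, n & v]).1 `<=` B (size v) \/ (node [:: m, n & v]).1 `<=` ~` B (size v).
Proof. by case: (nodeP (n :: v)) => _ _ [_ [_ _]]; apply. Qed.

Lemma clopen_node v : clopen (node v).1.
Proof.
have [n0|/set0P n0] := eqVneq (node v).1 set0; first by rewrite n0; exact: clopen0.
by have [/(_ n0)[]] := nodeP v.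
Qed.

Lemma top_node v : (node v).1 !=set0 -> (node v).1 (node v).2.
Proof. by move=> n0; have [/(_ n0)[]] := nodeP v. Qed.

(** The state [(v, r)] means: in node [v], with the first [r] children ruled out. The letter [true]
    enters child [r], and [false] rules it out. *)
Definition step (s : seq nat * nat) (l : bool) : seq nat * nat :=
  if l then (s.2 :: s.1, 0%N) else (s.1, s.2.+1).

Definition address (b : seq bool) := foldl step ([::], 0%N) b.

Definition remainder (s : seq nat * nat) :=
  (node s.1).1 `\` \bigcup_(j < s.2) (kids s.1 j).1.

Definition cell b := remainder (address b).

Lemma remainder0 v : remainder (v, 0%N) = (node v).1.
Proof. by rewrite /remainder /= II0 bigcup_set0 setD0. Qed.

Lemma remainder_top s : (node s.1).1 !=set0 -> remainder s (node s.1).2.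
Proof.
move=> n0; split; first exact: top_node.
move=> [j _ kj]; have [_ _ eC _] := children_node s.1.
by have [_ /(_ erefl)] := (eC (node s.1).2).2 (ex_intro _ j kj).
Qed.

Lemma kids_node v j : (kids v j).1 `<=` (node v).1.
Proof.
move=> x kx; have [_ _ eC _] := children_node v.
by have [] := (eC x).2 (ex_intro _ j kx).
Qed.

Lemma remainder_step s x : remainder s x <-> exists l, remainder (step s l) x.
Proof.
case: s => v r; have [_ dC _ _] := children_node v; split.
  move=> [nx nkx]; have [kx|nk] := pselect ((kids v r).1 x).
    by exists true; rewrite /step remainder0.
  exists false; split => // -[j /=]; rewrite ltnS leq_eqVlt => /orP[/eqP->//|jr kx].
  by apply: nkx; exists j.
move=> [[]]; rewrite /step /=.
  rewrite remainder0 => kx; split; first exact: kids_node kx.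
  by move=> [j /= jr kj]; have := dC _ _ _ kj kx => jr'; rewrite jr' ltnn in jr.
move=> [nx nkx]; split => // -[j /= jr kx]; apply: nkx; exists j => //=.
exact: ltnW.
Qed.

Lemma remainder_step_inj s l m x :
  remainder (step s l) x -> remainder (step s m) x -> l = m.
Proof.
have H : remainder (step s true) x -> ~ remainder (step s false) x.
  by case: s => v r; rewrite /step /= remainder0 => kx [_]; apply; exists r => /=.
by case: l m => -[] // h1 h2; case: H.
Qed.

Lemma address_rcons b l : address (rcons b l) = step (address b) l.
Proof. exact: foldl_rcons. Qed.

(** Dropping the first letter affects only the first index of the address, which is lowered by one
    or, if zero, removed; while that index is still being read, it is the counter that drops. *)
Lemma address_cons l b : let s := address (l :: b) in let t := address b in
  (s.1 = [::] /\ t.1 = [::] /\ s.2 = t.2.+1) \/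
  (s.1 != [::] /\ t.1 = pred_word s.1 /\ s.2 = t.2).
Proof.
rewrite /=; elim/last_ind: b => [|b m IH].
  by case: l; [right|left].
rewrite -rcons_cons !address_rcons; move: IH.
case: (address (l :: b)) (address b) => [v r] [w q] /=.
move=> [[-> [-> ->]]|[v0 [-> ->]]]; case: m => /=.
- by right.
- by left.
- by right; split => //; split => //; case: v v0 => // n v _; case: q.
- by right.
Qed.

(** The peak of a node lies in none of its children, so the cell is nonempty as soon as the node is;
    nodes are handled by domination. *)
Lemma cell_shift l b : cell (l :: b) !=set0 -> cell b !=set0.
Proof.
move=> [x [nx _]]; exists (node (address b).1).2; apply: remainder_top.
have [[_ [-> _]]|[+ [-> _]]] := address_cons l b.
  by exists u0.2; case: peak_u0.
move: nx; case: (address (l :: b)).1 => // n v nx _.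
by have [] := dominated_pred_word (ex_intro _ x nx).
Qed.

Lemma cell_nseq b v j r : address b = (v, j) ->
  address (b ++ nseq r false) = (v, (j + r)%N).
Proof.
rewrite /address foldl_cat => ->.
by elim: r j => [|r IH] j /=; rewrite ?addn0 // /step /= IH addSnnS.
Qed.

(** Points with the same cells share nodes of every depth: [x] is never the peak, since a peak stays
    in all remainders while [y] enters some child. But nodes of depth [n.+2] are decided by
    [B n]. *)
Lemma cell_separate x y : u0.1 x -> u0.1 y -> (forall b, cell b x -> cell b y) -> x = y.
Proof.
move=> Ax Ay xy; apply: contrapT => neq.
have long n : exists v b, [/\ size v = n, address b = (v, 0%N), (node v).1 x & (node v).1 y].
  elim: n => [|n [v [b [sv bv vx vy]]]]; first by exists [::], [::].
  have [_ _ eC _] := children_node v.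
  have [xt|xt] := pselect (x = (node v).2).
    have [r kr] := (eC y).1 (conj vy (fun yt => neq (etrans xt (esym yt)))).
    have br : address (b ++ nseq r.+1 false) = (v, r.+1) by rewrite (cell_nseq _ bv).
    have [] : cell (b ++ nseq r.+1 false) y.
      by apply: xy; rewrite /cell br xt; apply: remainder_top; exists x.
    by rewrite br => _; case; exists r => /=.
  have [r kr] := (eC x).1 (conj vx xt).
  have br : address (rcons (b ++ nseq r false) true) = (r :: v, 0%N).
    by rewrite address_rcons (cell_nseq _ bv).
  exists (r :: v), (rcons (b ++ nseq r false) true); split => //=; first by rewrite sv.
  have : cell (rcons (b ++ nseq r false) true) y.
    by apply: xy; rewrite /cell br remainder0.
  by rewrite /cell br remainder0.
have [_ _ sepB] := baseB; have [n Bx nBy] := sepB _ _ neq.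
have [[|m [|p v]] [b [//= [sv] _ vx vy]]] := long n.+2.
have [H|H] := node_decided m p v; rewrite sv in H.
  exact/nBy/H.
exact: H vx _.
Qed.

Lemma cell_scheme : shift_scheme u0.1 cell.
Proof.
split.
- by rewrite /cell /address remainder0.
- move=> b; apply: clopenD; first exact: clopen_node.
  by apply: clopen_bigcup_lt => i; exact: (clopen_node (i :: _)).
- split=> [b x|b l m x].
    by split=> [/remainder_step[l]|[l]]; rewrite /cell ?address_rcons;
       [exists l; rewrite address_rcons|move=> H; apply/remainder_step; exists l].
  by rewrite /cell !address_rcons; exact: remainder_step_inj.
- exact: cell_separate.
- exact: cell_shift.
Qed.

End Tree.

(** Each letter records the piece it belongs to, and words that mix pieces get an empty cell.
    Dropping a letter stays within a piece, or ends at the empty word. *)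
Lemma shift_scheme_union (X : topologicalType) (k : nat) (A : 'I_k -> set X)
    (U : 'I_k -> seq bool -> set X) :
  (forall i j x, A i x -> A j x -> i = j) -> (forall x, exists i, A i x) ->
  (forall i, shift_scheme (A i) (U i)) ->
  exists W : seq ('I_k * bool) -> set X, shift_scheme [set: X] W.
Proof.
move=> dA coverA sU.
pose W (b : seq ('I_k * bool)) := if b is (i, _) :: b' then
  [set x | all (fun l => l.1 == i) b' /\ U i (map snd b) x] else [set: X].
have UA i l b : U i (l :: b) `<=` A i.
  have [<- _ [eU _] _ _] := sU i.
  elim/last_ind: b => [|b m IH] x Ux.
    by apply/eU; exists l.
  by apply: IH; apply/eU; exists m; rewrite rcons_cons.
exists W; split => //.
- case=> [|[i l] b]; first exact: clopenT.
  rewrite /W; case: (all _ b).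
    have [_ cU _ _ _] := sU i.
    rewrite (_ : [set x | _] = U i (map snd ((i, l) :: b))) //.
    by apply/seteqP; split => [x []|].
  rewrite (_ : [set x | _] = set0); first exact: clopen0.
  by apply/seteqP; split => [x []|].
- split=> [b x|b [i l] [j m] x].
    case: b => [|[i l] b].
      split=> // _; have [i Ax] := coverA x.
      have [U0 _ [eU _] _ _] := sU i; move: Ax; rewrite -U0 => /eU[l Ul].
      by exists (i, l).
    have [U0 _ [eU _] _ _] := sU i; rewrite /W /=; split.
      move=> [ab /eU[m Um]]; exists (i, m).
      by rewrite all_rcons eqxx ab map_rcons -rcons_cons.
    move=> [[j m] []]; rewrite all_rcons map_rcons => /andP[_ ab] Um; split => //.
    by apply/eU; exists m.
  case: b => [|[p q] b].
    rewrite /W /= => -[_ Ul] [_ Um].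
    have ij : i = j by apply: (dA _ _ x); [exact: UA Ul|exact: UA Um].
    have [_ _ [_ dU] _ _] := sU i.
    by rewrite -ij in Um *; rewrite (dU [::] _ _ _ Ul Um).
  rewrite /W /= !all_rcons !map_rcons => -[/andP[/eqP/= -> _] Ul] [/andP[/eqP/= -> _] Um].
  have [_ _ [_ dU] _ _] := sU p.
  by rewrite (dU (q :: map snd b) _ _ _ Ul Um).
- move=> x y _ _ xy; have [i Ax] := coverA x.
  have [U0 _ [eU _] sepU _] := sU i.
  have WU b : b != [::] -> W (map (pair i) b) = U i b.
    case: b => // l b _; rewrite /W /= all_map -map_comp /=.
    have -> : map (snd \o pair i) b = b by elim: b => //= a b ->.
    have -> : all (preim (pair i) (fun l0 => l0.1 == i)) b by apply/allP => a _ /=.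
    by apply/seteqP; split => [z []|].
  have UU b : b != [::] -> U i b x -> U i b y by move=> /WU <-; exact: xy.
  have Ay : A i y.
    have : U i [::] x by rewrite U0.
    by move=> /eU[l /(UU [:: l] isT)]; exact: UA.
  by apply: sepU => // -[|l b]; [rewrite U0|exact: UU].
- move=> [i l] [|[j m] b] [x]; first by exists x.
  move=> [/= /andP[/eqP ji ab] Ux].
  have [_ _ _ _ shU] := sU i.
  have [z Uz] := shU l (m :: map snd b) (ex_intro _ x Ux).
  by exists z; split; rewrite /= ji.
Qed.

(** * From subshifts to ultrafractals *)

Section Itineraries.
Variables (X : topologicalType) (L : finType) (U : seq L -> set X).
Hypothesis compactX : compact [set: X].
Hypothesis schemeU : shift_scheme [set: X] U.

Lemma U_cat b c : U (b ++ c) `<=` U b.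
Proof.
have [_ _ [eU _] _ _] := schemeU.
elim/last_ind: c => [|c l IH] x; first by rewrite cats0.
by rewrite -rcons_cat => Ux; apply: IH; apply/eU; exists l.
Qed.

Lemma U_uniq b c x : size b = size c -> U b x -> U c x -> b = c.
Proof.
have [_ _ [eU dU] _ _] := schemeU.
elim/last_ind: b c => [|b l IH] c; first by move/esym/size0nil.
elim/last_ind: c => [|c m _]; first by rewrite size_rcons.
rewrite !size_rcons => -[bc] Ub Uc; have ebc : b = c.
  by apply: IH => //; apply/eU; [exists l|exists m].
by rewrite -ebc in Uc *; rewrite (dU _ _ _ _ Ub Uc).
Qed.

Lemma itinerary_exists x n : exists b, size b = n /\ U b x.
Proof.
have [U0 _ [eU _] _ _] := schemeU.
elim: n => [|n [b [<- /eU[l Ul]]]]; first by exists [::]; rewrite U0.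
by exists (rcons b l); rewrite size_rcons.
Qed.

Definition itinerary x n := projT1 (cid (itinerary_exists x n)).

Lemma size_itinerary x n : size (itinerary x n) = n.
Proof. by rewrite /itinerary; case: cid => b []. Qed.

Lemma U_itinerary x n : U (itinerary x n) x.
Proof. by rewrite /itinerary; case: cid => b []. Qed.

Lemma itinerary_eq b x n : size b = n -> U b x -> itinerary x n = b.
Proof.
by move=> bn Ub; apply: U_uniq (U_itinerary x n) Ub; rewrite size_itinerary.
Qed.

Lemma take_itinerary x m n : (m <= n)%N -> take m (itinerary x n) = itinerary x m.
Proof.
move=> mn; apply/esym/itinerary_eq; first by rewrite size_takel ?size_itinerary.
by apply: (@U_cat _ (drop m (itinerary x n))); rewrite cat_take_drop; exact: U_itinerary.
Qed.

Definition agree x y n := itinerary x n = itinerary y n.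

Lemma agree_le x y m n : (m <= n)%N -> agree x y n -> agree x y m.
Proof.
by move=> mn xy; rewrite /agree -(take_itinerary x mn) -(take_itinerary y mn) xy.
Qed.

Lemma agree0 x y : agree x y 0.
Proof. by rewrite /agree !(@itinerary_eq [::] _ 0) //; case: schemeU => ->. Qed.

Lemma agreeP x y n : agree x y n <-> U (itinerary x n) y.
Proof.
split=> [->|Uy]; first exact: U_itinerary.
by rewrite /agree (itinerary_eq _ Uy) // size_itinerary.
Qed.

Lemma agree_eq x y : (forall n, agree x y n) -> x = y.
Proof.
move=> xy; have [_ _ _ sepU _] := schemeU; apply: sepU => // b Ub.
by rewrite -(itinerary_eq erefl Ub); exact/agreeP.
Qed.

Lemma cell_nbhs x n : nbhs x (U (itinerary x n)).
Proof.
have [_ cU _ _ _] := schemeU.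
by apply: open_nbhs_nbhs; split; [case: (cU (itinerary x n))|exact: U_itinerary].
Qed.

(** The closed cells around [x] are nested and meet only in [x], so by compactness one of them
    misses the complement of [N]. *)
Lemma nbhs_cell x N : nbhs x N -> exists n, U (itinerary x n) `<=` N.
Proof.
have [_ cU _ _ _] := schemeU.
rewrite nbhsE => -[G [oG Gx] GN].
have compO : compact (~` G).
  by apply: closed_compact_space => //; exact: open_closedC.
have [n|i j|y nGy|n nG] := nested_closed_empty (C := fun n => U (itinerary x n))
    compO (inhabits 0%N).
- by case: (cU (itinerary x n)).
- case/orP: (leq_total i j) => ij; [right|left] => y /agreeP xy; apply/agreeP;
    exact: (agree_le ij xy).
- apply: contrapT => nn; apply: nGy; have <- // : x = y.
  by apply: agree_eq => n; apply/agreeP; apply: contrapT => nU; apply: nn; exists n.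
- exists n => y Uy; apply: GN; apply: contrapT => nGy.
  by have : (~` G `&` U (itinerary x n)) y by []; rewrite nG.
Qed.

(* The branch prefixes [l] to the itinerary; when the resulting word leaves
   the set of itineraries, its image is a point chosen in the last cell met. *)
Lemma branch_exists l : U [:: l] !=set0 ->
  exists f : X -> X, (forall z, U [:: l] z <-> range f z) /\
    forall x y n, agree x y n -> agree (f x) (f y) n.+1.
Proof.
move=> [z0 Uz0]; have [U0 cU [eU _] _ shU] := schemeU.
(* The chosen point depends on the word alone, so that points with a common prefix can get the same
   image. *)
pose pt b := if pselect (U b !=set0) is left h then projT1 (cid h) else z0.
have ptP b : U b !=set0 -> U b (pt b).
  by move=> Ub; rewrite /pt; case: pselect => // h; exact: (projT2 (cid h)).
pose ok x n := U (l :: itinerary x n) !=set0.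
have U_le x m n : (m <= n)%N -> U (l :: itinerary x n) `<=` U (l :: itinerary x m).
  move=> mn; rewrite -(take_itinerary x mn) -{1}(cat_take_drop m (itinerary x n)).
  by rewrite -cat_cons; exact: U_cat.
have ok_le x m n : (m <= n)%N -> ok x n -> ok x m by move=> mn [z /(U_le _ _ _ mn)]; exists z.
have ok0 x : ok x 0%N.
  by exists z0; rewrite (@itinerary_eq [::] x 0) // U0.
have last_ok x n : ~ ok x n -> exists2 m, (m < n)%N & ok x m /\ ~ ok x m.+1.
  elim: n => [//|n IH nok]; have [okn|/IH[m mn H]] := pselect (ok x n); first by exists n.
  by exists m => //; exact: ltnW.
have /choice[f fP] : forall x, exists z, (forall n, ok x n -> U (l :: itinerary x n) z) /\
    (forall n, ok x n -> ~ ok x n.+1 -> z = pt (l :: itinerary x n)).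
  move=> x; have [okx|] := pselect (forall n, ok x n).
    suff [z Uz] : exists z, forall n, U (l :: itinerary x n) z.
      by exists z; split => // n _ /(_ (okx n.+1)).
    apply: contrapT => nz.
    have [n|i j|y _|n] := nested_closed_empty (C := fun n => U (l :: itinerary x n))
      compactX (inhabits 0%N).
    - by case: (cU (l :: itinerary x n)).
    - by case/orP: (leq_total i j) => ij; [right|left]; exact: U_le.
    - apply: contrapT => nn; apply: nz; exists y => n.
      by apply: contrapT => nU; apply: nn; exists n.
    - by rewrite setTI => Un; have [z] := okx n; rewrite Un.
  move=> /existsNP[n /last_ok[m _ [okm nokm]]].
  exists (pt (l :: itinerary x m)); split=> i oki.
    apply: (U_le x i m); last exact: ptP.
    by rewrite leqNgt; apply/negP => mi; apply: nokm; exact: ok_le mi oki.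
  move=> noki; case: (ltngtP m i) => [mi|im|->] //.
    by case: nokm; exact: ok_le mi oki.
  by case: noki; exact: ok_le im okm.
have fl x : U [:: l] (f x).
  by have [/(_ 0%N (ok0 x)) + _] := fP x; rewrite (@itinerary_eq [::] x 0) // U0.
exists f; split.
- move=> z; split=> [Uz|[x _ <-]]; last exact: fl.
  (* Surjectivity: the tails of the itinerary of [z] have nonempty cells by shift-invariance, and a
     common point of these nested cells is a preimage of [z]. *)
  have zc n : itinerary z n.+1 = l :: behead (itinerary z n.+1).
    have := take_itinerary z (isT : (1 <= n.+1)%N); rewrite (@itinerary_eq [:: l] z 1) //.
    by case: (itinerary z n.+1) => //= a b [->].
  have Ub n : U (behead (itinerary z n.+1)) !=set0.
    by apply: (shU l); rewrite -zc; exists z; exact: U_itinerary.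
  suff [x xP] : exists x, forall n, U (behead (itinerary z n.+1)) x.
    exists x => //; apply: agree_eq => -[|n]; first exact: agree0.
    have xn : itinerary x n = behead (itinerary z n.+1).
      by apply: itinerary_eq => //; rewrite size_behead size_itinerary.
    have okn : ok x n by rewrite /ok xn -zc; exists z; exact: U_itinerary.
    have [/(_ n okn) Uf _] := fP x; apply: itinerary_eq; first by rewrite size_itinerary.
    by rewrite zc -xn.
  apply: contrapT => nx.
  have [n|i j|y _|n] := nested_closed_empty (C := fun n => U (behead (itinerary z n.+1)))
      compactX (inhabits 0%N).
  + by case: (cU (behead (itinerary z n.+1))).
  + have le p q : (p <= q)%N -> U (behead (itinerary z q.+1)) `<=` U (behead (itinerary z p.+1)).
      move=> pq; have := take_itinerary z (pq : (p.+1 <= q.+1)%N).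
      rewrite (zc q) /= => <- /=; rewrite -{1}(cat_take_drop p (behead (itinerary z q.+1))).
      exact: U_cat.
    by case/orP: (leq_total i j) => ij; [right|left]; exact: le.
  + apply: contrapT => nn; apply: nx; exists y => n.
    by apply: contrapT => nU; apply: nn; exists n.
  + by rewrite setTI => Un; have [y] := Ub n; rewrite Un.
(* Either the prefixed word of length [n.+1] is admissible and its cell contains both images, or
   both words leave the subshift at the same place and the images coincide. *)
- move=> x y n xy; have [okn|nokn] := pselect (ok x n).
    have [/(_ n okn) Ux _] := fP x.
    have okny : ok y n by rewrite /ok -xy.
    have [/(_ n okny) Uy _] := fP y.
    rewrite /agree (itinerary_eq _ Ux) ?(itinerary_eq _ Uy) ?xy //=.
      by rewrite size_itinerary.
    by rewrite size_itinerary.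
  have [m mn [okm nokm]] := last_ok x n nokn.
  have xym : itinerary x m = itinerary y m by apply: agree_le xy; exact: ltnW.
  have xym1 : itinerary x m.+1 = itinerary y m.+1 by apply: agree_le xy.
  have [_ /(_ m okm nokm) ->] := fP x; have [_ /(_ m)] := fP y.
  by rewrite /ok -xym -xym1 => /(_ okm nokm) ->.
Qed.

End Itineraries.

(** * The ultrametric defined by itineraries *)

Section ItineraryMetric.
Local Open Scope ring_scope.
Variables (X : topologicalType) (L : finType) (U : seq L -> set X).
Hypothesis compactX : compact [set: X].
Hypothesis schemeU : shift_scheme [set: X] U.
Variables (R : realType) (e : R).
Hypotheses (e0 : 0 < e) (e1 : e < 1).

Let agr := agree schemeU.

Lemma disagree_exists x y : x <> y -> exists n, `[< ~ agr x y n >].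
Proof.
move=> xy; apply: contrapT => nn; apply: xy; apply: (@agree_eq _ _ _ schemeU) => n.
by apply: contrapT => nag; apply: nn; exists n; exact/asboolP.
Qed.

(** The exponent is the least length at which the itineraries differ, one more than the length of
    the common prefix. *)
Definition itinerary_dist x y : R :=
  if pselect (x = y) is right xy then e ^+ ex_minn (disagree_exists xy) else 0.

Lemma itinerary_distxx x : itinerary_dist x x = 0.
Proof. by rewrite /itinerary_dist; case: pselect. Qed.

Lemma itinerary_distP x y : x <> y ->
  exists n, [/\ itinerary_dist x y = e ^+ n.+1, agr x y n & ~ agr x y n.+1].
Proof.
move=> xy; rewrite /itinerary_dist; case: pselect => // xy'.
case: ex_minnP => -[/asboolP[]|n /asboolP nag minn]; first exact: agree0.
exists n; split => //; apply: contrapT => nagn.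
by have := minn n (asboolT nagn); rewrite ltnn.
Qed.

Lemma itinerary_dist_ge0 x y : 0 <= itinerary_dist x y.
Proof.
have [->|/itinerary_distP[n [-> _ _]]] := pselect (x = y).
  by rewrite itinerary_distxx.
by rewrite exprn_ge0 // ltW.
Qed.

(** The case [k = 1] is the Lipschitz bound for the branches; [k = 0] is the monotonicity behind the
    ultrametric inequality. *)
Lemma itinerary_dist_le x y x' y' k :
  (forall n, agr x' y' n -> agr x y (n + k)%N) ->
  itinerary_dist x y <= e ^+ k * itinerary_dist x' y'.
Proof.
move=> ag; have [->|xy] := pselect (x = y).
  by rewrite itinerary_distxx mulr_ge0 ?exprn_ge0 ?itinerary_dist_ge0 // ltW.
have [xy'|xy'] := pselect (x' = y').
  case: xy; apply: (@agree_eq _ _ _ schemeU) => n.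
  by apply: (agree_le (leq_addr k n)); apply: ag; rewrite xy'.
have [n [-> _ nag]] := itinerary_distP xy.
have [m [-> agm _]] := itinerary_distP xy'.
rewrite -exprD; apply: ler_wiXn2l; rewrite ?ltW // addnC addSn ltnS.
rewrite leqNgt; apply/negP => lt_n; apply: nag.
exact: agree_le lt_n (ag m agm).
Qed.

Lemma itinerary_ultrametric : is_ultrametric itinerary_dist.
Proof.
have le_agr x y x' y' : (forall n, agr x' y' n -> agr x y n) ->
    itinerary_dist x y <= itinerary_dist x' y'.
  move=> ag; rewrite -[leRHS]mul1r; apply: (@itinerary_dist_le x y x' y' 0) => n.
  by rewrite addn0; exact: ag.
have ultra x y z : itinerary_dist x z <= Num.max (itinerary_dist x y) (itinerary_dist y z).
  rewrite le_max; have [xyz|] := pselect (forall n, agr x y n -> agr y z n).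
    by rewrite le_agr // => n xy; rewrite /agr /agree xy; exact: xyz.
  move=> /existsNP[m /not_implyP[xym nyzm]].
  apply/orP; right; apply: le_agr => n yz; rewrite /agr /agree -yz.
  apply: agree_le xym; rewrite leqNgt; apply/negP => mn.
  by apply: nyzm; apply: agree_le yz; exact: ltnW.
split => //; split.
- exact: itinerary_dist_ge0.
- move=> x y; split=> [|->]; last exact: itinerary_distxx.
  apply: contraPP => /itinerary_distP[n [-> _ _]] /eqP.
  by rewrite expf_eq0 gt_eqF.
- by move=> x y; apply/le_anti/andP; split; apply: le_agr => n /esym.
- move=> x y z; apply: le_trans (ultra x y z) _.
  by rewrite ge_max lerDl lerDr !itinerary_dist_ge0.
Qed.

Lemma itinerary_generates : generates_topology itinerary_dist.
Proof.
move=> x; apply/seteqP; split=> V.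
  move=> /(nbhs_cell compactX schemeU)[n UV].
  exists (e ^+ n); first by rewrite /= exprn_gt0.
  move=> y /= lt_xy; apply: UV; apply/agreeP.
  have [->//|/itinerary_distP[m [dxy agm _]]] := pselect (x = y).
  apply: agree_le agm; rewrite -ltnS.
  by move: lt_xy; rewrite dxy ltr_iXn2l.
move=> [r /= r0 ballV].
have [n en] : exists n, e ^+ n < r.
  have ne1 : `|e| < 1 by rewrite ger0_norm // ltW.
  have /cvgr0Pnorm_lt/(_ _ r0)[n _ /(_ n (leqnn n))] := cvg_expr ne1.
  by rewrite ger0_norm ?exprn_ge0 ?ltW// => en; exists n.
apply: filterS (cell_nbhs schemeU x n) => y /agreeP ag; apply: ballV => /=.
have [->|/itinerary_distP[m [-> _ nag]]] := pselect (x = y).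
  by rewrite itinerary_distxx.
apply: le_lt_trans en; apply: ler_wiXn2l; rewrite ?ltW //.
rewrite leqNgt; apply/negP => mn; apply: nag; apply: agree_le ag.
exact: ltnW.
Qed.

End ItineraryMetric.

Lemma shift_scheme_ultrafractal (R : realType) (X : topologicalType) (L : finType)
    (U : seq L -> set X) :
  compact [set: X] -> shift_scheme [set: X] U -> Banach_ultrafractal R X.
Proof.
move=> compactX schemeU; split => //.
pose good l := U [:: l] !=set0.
have /choice[f fP] : forall l, exists f : X -> X, good l ->
    (forall z, U [:: l] z <-> range f z) /\
    forall x y n, agree schemeU x y n -> agree schemeU (f x) (f y) n.+1.
  move=> l; have [/(branch_exists compactX schemeU)[f fP]|nl] := pselect (good l).
    by exists f.
  by exists id.
have [U0 cU [eU dU] sepU shU] := schemeU.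
exists (f @` good); split.
- by apply: finite_image; exact: finite_finset.
- move=> _ [l /fP[_ agf] <-] x V /(nbhs_cell compactX schemeU)[n UV].
  apply: filterS (cell_nbhs schemeU x n) => y /agreeP/agf/agree_le ag.
  by apply: UV; apply/agreeP/ag.
- apply/seteqP; split=> // x _.
  have : U [::] x by rewrite U0.
  move=> /eU[l /= Ul]; have gl : good l by exists x.
  by exists (f l); [exists l|apply/(fP l gl).1].
- move=> _ _ [l gl <-] [m gm <-] [x [/(fP l gl).1 Ul /(fP m gm).1 Um]].
  by rewrite (dU [::] _ _ _ Ul Um).
(* The minimum keeps the base of the powers below 1, and halving makes both inequalities strict. *)
- move=> eps eps0; pose e : R := (Num.min eps 1 / 2)%R.
  have e0 : (0 < e)%R by rewrite divr_gt0 // lt_min eps0 ltr01.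
  have [e_eps e1] : (e < eps /\ e < 1)%R.
    apply/andP; rewrite -lt_min ltr_pdivrMr // ltr_pMr ?ltr1n //.
    by rewrite lt_min eps0 ltr01.
  exists (itinerary_dist schemeU e); split.
  + exact: itinerary_ultrametric.
  + exact: itinerary_generates.
  + apply: (@le_lt_trans _ _ e%:E); last by rewrite lte_fin.
    apply: ge_ereal_sup => _ [->|[_ [x [y [[l gl <-] xy ->]]]]].
      by rewrite lee_fin ltW.
    rewrite lee_fin ler_pdivrMr.
      apply: (@itinerary_dist_le _ _ _ schemeU R e e0 e1 _ _ _ _ 1) => n.
      by rewrite addn1; exact: (fP l gl).2.
    rewrite lt_neqAle itinerary_dist_ge0 // andbT eq_sym.
    have [[_ d0 _ _] _] := itinerary_ultrametric schemeU e0 e1.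
    by apply/eqP => /d0.
Qed.

(** For each [k] compactness gives a countable cover by clopen sets of small diameter; the base
    enumerates all of these covers. *)
Lemma countable_clopen_base (R : realType) (X : topologicalType) :
  has_clopen_base X -> compact [set: X] -> metrizable R X ->
  exists B : nat -> set X, clopen_base B.
Proof.
move=> [B' [_ baseB'] B'clopen] compactX [d [[d_ge0 d0 dC dtri] gend]].
pose small k (C : set X) := forall x y, C x -> C y -> (d x y < k.+1%:R^-1)%R.
have ballP x r : (0 < r)%R -> nbhs x [set y | (d x y < r)%R].
  by move=> r0; rewrite gend; exists r.
have coverP k : exists C : nat -> set X,
    (forall i, clopen (C i) /\ small k (C i)) /\ forall x, exists i, C i x.
  pose Q S := exists C : nat -> set X,
    (forall i, clopen (C i) /\ small k (C i)) /\ forall x, S x -> exists i, C i x.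
  suff [C [CP cC]] : Q [set: X] by exists C; split => // x; exact: cC.
  apply: compact_induction => //.
  - by exists (fun=> set0); split=> // i; split => //; exact: clopen0.
  - by move=> A A' AA' [C [CP cC]]; exists C; split => // x /AA'; exact: cC.
  - move=> A A' [C [CP cC]] [C' [CP' cC']].
    exists (fun i => if odd i then C' i./2 else C i./2); split=> [i|x].
      by case: odd.
    move=> [/cC[i Cx]|/cC'[i Cx]]; first by exists i.*2; rewrite odd_double doubleK.
    by exists i.*2.+1; rewrite /= odd_double /= uphalf_double.
  - move=> x _; have r0 : (0 < k.+1%:R^-1 / 2 :> R)%R by rewrite divr_gt0.
    have [A [BA Ax] AN] := baseB' x _ (ballP x _ r0).
    exists A; first by apply: open_nbhs_nbhs; split => //; case: (B'clopen A BA).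
    exists (fun=> A); split=> [_|y [_ Ay]]; last by exists 0%N.
    split; first exact: B'clopen.
    move=> y z /AN /= xy /AN /= xz; apply: le_lt_trans (dtri y x z) _.
    by rewrite [ltRHS]splitr dC ltrD.
have {coverP}/choice[C CP] := coverP.
pose B j := if @pickle_inv (nat * nat)%type j is Some p then C p.1 p.2 else set0.
have BE k i : B (pickle (k, i)) = C k i by rewrite /B pickleK_inv.
have baseB x N : nbhs x N -> exists2 n, B n x & B n `<=` N.
  rewrite gend => -[r /= r0 ballN].
  have [k kr] : exists k, (k.+1%:R^-1 < r)%R.
    by have [k _ /(_ k (leqnn k))] := near_infty_natSinv_lt (PosNum r0); exists k.
  have [_ /(_ x)[i Cx]] := CP k; exists (pickle (k, i)); rewrite BE //.
  move=> y Cy; apply: ballN => /=; apply: lt_trans kr.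
  by have [/(_ i)[_ sm] _] := CP k; exact: sm.
exists B; split => //.
- move=> n; rewrite /B; case: pickle_inv => [p|]; last exact: clopen0.
  by have [/(_ p.2)[]] := CP p.1.
- move=> x y xy.
  have dxy : (0 < d x y)%R.
    by rewrite lt_neqAle d_ge0 andbT eq_sym; apply/eqP => /d0.
  have [n Bx BN] := baseB x _ (ballP x _ dxy).
  by exists n => // /BN /=; rewrite ltxx.
Qed.

(** * The height *)

Section Height.
Variable X : topologicalType.
Hypothesis compactX : compact [set: X].

(** A child of the height is a child of the rank of some [x], and [x] survives in the derived set of
    that stage. By compactness these nested closed sets have a common point, so the height is
    attained. *)
Lemma CB_height : scattered X -> [set: X] !=set0 ->
  CB_derivative X (ord_sup (@rank X)) !=set0 /\
  CB_derivative X (succ_ord (ord_sup (@rank X))) = set0.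
Proof.
move=> /scatteredP ker0 [x0 _].
have rankP (x : X) : has_rank x (rank x) by exact: (rank_spec (ker0 x)).
split; last first.
  apply/seteqP; split=> // x ax; have [_ nx] := rankP x; apply: nx.
  exact: CB_derivative_anti (succ_ord_le (ord_sup_ub _ x)) _ ax.
apply/set0P/negP => /eqP a0.
pose I := {x : X & ord_index (rank x)}.
pose C (p : I) := derived_set (CB_derivative X (ord_child (projT2 p))).
(* With no index the height is zero, and its stage is the whole space. *)
have [I0|nI] := pselect (inhabited I); last first.
  have : CB_derivative X (ord_sup (@rank X)) x0 by move=> p _; case: nI.
  by rewrite a0.
have [p|p q|x _|p] := nested_closed_empty (C := C) compactX I0.
- exact/closed_derived_set/CB_closed.
- by rewrite /C -!CB_succE; exact: CB_nested.
- apply: contrapT => np.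
  have : CB_derivative X (ord_sup (@rank X)) x.
    by move=> p _; apply: contrapT => nCp; apply: np; exists p.
  by rewrite a0.
- rewrite setTI => Cp; have [+ _] := rankP (projT1 p).
  have := ord_child_lt (projT2 p) => /CB_derivative_anti le /le.
  by rewrite CB_succE -/(C p) Cp.
Qed.

Definition has_predecessor (t : X) :=
  exists2 y, rank_lt y t & forall x, rank_lt x t -> rank_le x y.

(** If the height is infinity, [t] is in the kernel and is its own predecessor. If it is the
    successor of [b], then [t] is alone in its stage near itself but accumulates stage [b], which
    yields a point of rank exactly [b]. *)
Lemma top_predecessor t : (forall x, rank_le x t) ->
  scattered_height X = None \/
    (exists a, scattered_height X = Some a /\
       (is_zero_ord a \/ (countable_ord a /\ is_succ_ord a))) ->
  (forall x, ~ rank_lt x t) \/ has_predecessor t.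
Proof.
move=> maxt; rewrite /scattered_height; case: asboolP => [scX|nscX]; last first.
  move=> _; right; exists t => [a _|x _]; last exact: maxt.
  have [x kerx] : exists x, forall a, CB_derivative X a x.
    apply: contrapT => nker; apply/nscX/scatteredP => x.
    apply: contrapT => nx; apply: nker; exists x => b.
    by apply: contrapT => nxb; apply: nx; exists b.
  exact/maxt/kerx.
have [|[z az] sa0] := CB_height scX; first by exists t.
move=> [//|[a [[ha]]]]; rewrite {}ha in az sa0 => -[a0|[_ [b ab]]].
  left=> x xt.
  have : CB_derivative X (succ_ord zero_ord) t by apply: xt => -[].
  move/(CB_derivative_anti (succ_ord_le a0.1)).
  by rewrite sa0.
right.
have bt : CB_derivative X (succ_ord b) t by apply/maxt/(CB_derivative_anti ab.2 az).
have nbt : ~ CB_derivative X (succ_ord (succ_ord b)) t.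
  by move/(CB_derivative_anti (succ_ord_le ab.1)); rewrite sa0.
have [N tN Nb] : exists2 N, nbhs t N &
    forall y, N y -> CB_derivative X (succ_ord b) y -> y = t.
  apply: contrapT => nN; apply: nbt; rewrite CB_succE; apply/derived_setP; split => // N tN.
  apply: contrapT => ny; apply: nN; exists N => // y Ny yb.
  by apply: contrapT => yt; apply: ny; exists y.
move: (bt); rewrite CB_succE => /derived_setP[_ /(_ N tN)[y [Ny yb yt]]].
have nyb : ~ CB_derivative X (succ_ord b) y by move/(Nb y Ny).
exists y => [c yc|x xt c xc].
  have [bc|cb] := ord_le_or_lt (succ_ord b) c.
    by case: nyb; exact: CB_derivative_anti bc _ yc.
  exact: CB_derivative_anti cb _ bt.
have [cb|bc] := ord_le_or_lt c b; first exact: CB_derivative_anti cb _ yb.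
by case: nbt; apply: CB_derivative_anti (succ_ord_le bc) _ (xt c xc).
Qed.

Variable B : nat -> set X.
Hypothesis baseB : clopen_base B.

(** With a predecessor [y], the children of the root all have exactly the rank of [y], so their
    ranks are trivially non-increasing. With nothing ranked below [q], the piece is a single
    point. *)
Lemma peak_scheme A q : peak A q ->
  (forall x, ~ rank_lt x q) \/ has_predecessor q ->
  exists U : seq bool -> set X, shift_scheme A U.
Proof.
move=> pAq pred.
suff [k [chk dom0 domS]] : exists k, [/\ children (A, q) k,
    dominated (k 0%N) (A, q) & forall n, dominated (k n.+1) (k n)].
  exact: ex_intro _ _ (@cell_scheme X B baseB compactX (A, q) k pAq chk dom0 domS).
have [cA Aq ltA] := pAq.
case: pred => [nlt|[y yq maxy]].
  exists (fun=> (set0, q)); split=> [|[? []]|_ [? []]//].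
  split=> //= [_|x|_ [? []]//]; first exact: clopen0.
  by split=> [[Ax xq]|[]//]; case: (nlt x); exact: ltA.
have [k chk kP] := equal_height_children baseB compactX (u := (A, q)) pAq yq.
have [_ _ eC pC] := chk.
have kq n : rank_lt (k n).2 q.
  have [kn _] := kP n; have [_ topk _] := pC n kn.
  by have [? ?] := (eC _).2 (ex_intro _ n topk); exact: ltA.
exists k; split => //.
- by move=> _; split; [exists q|exact/rank_ltW/kq].
- move=> n _; have [? yk] := kP n; split => //.
  exact: rank_le_trans (maxy _ (kq n.+1)) yk.
Qed.

End Height.

Lemma height_ultrafractal (R : realType) (X : topologicalType) :
  has_clopen_base X -> compact [set: X] -> metrizable R X ->
  scattered_height X = None \/
    (exists a, scattered_height X = Some a /\
       (is_zero_ord a \/ (countable_ord a /\ is_succ_ord a))) ->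
  Banach_ultrafractal R X.
Proof.
move=> hzero compactX hmetr hX; have [B baseB] := countable_clopen_base hzero compactX hmetr.
suff [k [A [t [dA coverA pA tP]]]] : exists k (A : 'I_k -> set X) (t : 'I_k -> X),
    [/\ forall i j x, A i x -> A j x -> i = j, forall x, exists i, A i x,
        forall i, peak (A i) (t i) & forall i x, rank_le x (t i)].
  have /choice[U UP] : forall i, exists U : seq bool -> set X, shift_scheme (A i) U.
    by move=> i; apply: (peak_scheme compactX baseB (pA i)); exact: top_predecessor.
  have [W WP] := shift_scheme_union dA coverA UP.
  exact: shift_scheme_ultrafractal WP.
have [[x0]|nX] := pselect (inhabited X); last first.
  have t0 : 'I_0 -> X by case.
  exists 0%N, (fun=> set0), t0.
  by split=> [[]//|x|[]//|[]//]; case: nX.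
(* Every peak of this partition has the maximal rank in [X], as [top_predecessor] requires. *)
have [k [C [t [[cC dC eC pC] sC]]]] := clopen_peak_partition baseB compactX x0 clopenT.
have lt_k i x : C i x -> (i < k)%N by have := sC i; case: ifP => // _ ->.
exists k, (fun i => C i), (fun i => t i); split.
- by move=> i j x Ci Cj; exact/val_inj/(dC _ _ x).
- move=> x; have [i Ci] := (eC x).1 Logic.I.
  by exists (Ordinal (lt_k i x Ci)).
- by move=> i; apply: pC; have := sC i; rewrite ltn_ord => -[].
- by move=> i x; have := sC i; rewrite ltn_ord => -[_]; apply.
Qed.

(** * Banach and topological fractals *)

Lemma ultrafractal_Banach (R : realType) (X : topologicalType) :
  metrizable R X -> Banach_ultrafractal R X -> Banach_fractal R X.
Proof.
move=> hmetr [compactX [F [finF _ covF _ ultraF]]]; split=> //.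
exists F; split => //; have [d [[md _] gend LipF]] := ultraF 1%R ltr01.
exists d; split=> // f Ff; apply: le_lt_trans LipF; apply: ereal_sup_le.
by move=> _ [->|[_ [x [y [-> xy ->]]]]]; [left|right; exists f, x, y].
Qed.

(** Words of length [n] shrink distances by [lam ^+ n], so for large [n] their images lie in balls
    whose radius is a Lebesgue number of the cover. *)
Lemma Banach_topological (R : realType) (X : topologicalType) :
  Banach_fractal R X -> topological_fractal X.
Proof.
move=> [compactX _ [F [finF covF [d [[d_ge0 d0 dC dtri] gend LipF]]]]].
have ballP x r : (0 < r)%R -> nbhs x [set y | (d x y < r)%R].
  by move=> r0; rewrite gend; exists r.
split.
  move=> p q clpq; apply/d0/le_anti; rewrite d_ge0 andbT leNgt; apply/negP => dpq.
  have dpq2 : (0 < d p q / 2)%R by rewrite divr_gt0.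
  have [z [/= pz qz]] := clpq _ _ (ballP p _ dpq2) (ballP q _ dpq2).
  have := dtri p z q; rewrite leNgt => /negP; apply.
  by rewrite [ltRHS]splitr (dC z) ltrD.
have [[x0]|nX] := pselect (inhabited X); last first.
  exists set0; split=> //; first by apply/seteqP; split=> // x; case: nX.
  (* The cover may be empty, so length 0 would not do; there are no words of length 1 over the empty
     system. *)
  move=> V _ _; exists 1%N => fs /(_ ord0) [].
have [lam [lam0 lam1 lamP]] : exists lam : R, [/\ (0 <= lam)%R, (lam < 1)%R
    & forall f, F f -> forall x y, (d (f x) (f y) <= lam * d x y)%R].
  have [l Fl] : exists l : seq (X -> X), F = [set` l] by exact/finite_seqP.
  have {LipF}: forall f, f \in l -> (Lip d [set f] < 1)%E by move=> f fl; apply: LipF; rewrite Fl.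
  suff H : (forall f, f \in l -> (Lip d [set f] < 1)%E) ->
      exists lam : R, [/\ (0 <= lam)%R, (lam < 1)%R
    & forall f, f \in l -> forall x y, (d (f x) (f y) <= lam * d x y)%R].
    by move=> /H[lam [? ? lamP]]; exists lam; split => // f; rewrite Fl; exact: lamP.
  elim: l {Fl} => [|g l IH] gl; first by exists 0%R; split.
  have [f fl|lam [lam0 lam1 lamP]] := IH; first by apply: gl; rewrite inE fl orbT.
  have Lg1 := gl g (mem_head _ _).
  have Lg0 : (0 <= Lip d [set g])%E by apply: ereal_sup_ubound; left.
  have Lgf : Lip d [set g] \is a fin_num.
    by rewrite ge0_fin_numE // (lt_trans Lg1) // ltry.
  exists (Num.max lam (fine (Lip d [set g]))); split.
  - by rewrite le_max lam0.
  - by rewrite gt_max lam1 /= -lte_fin fineK.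
  - move=> f; rewrite inE => /orP[/eqP->|fl] x y; last first.
      by apply: le_trans (lamP f fl x y) _; rewrite ler_wpM2r // le_max lexx.
    have [->|xy] := pselect (x = y); first by rewrite !(d0 _ _).2 // mulr0.
    have dxy : (0 < d x y)%R by rewrite lt_neqAle d_ge0 andbT eq_sym; apply/eqP => /d0.
    rewrite -ler_pdivrMr // le_max; apply/orP; right.
    by rewrite -lee_fin fineK //; apply: ereal_sup_ubound; right; exists g, x, y.
exists F; split => //.
- move=> f Ff x V; rewrite gend => -[r /= r0 ballV]; apply: filterS (ballP x r r0).
  move=> y /= xy; apply: ballV => /=; apply: le_lt_trans xy.
  apply: le_trans (lamP f Ff x y) _; rewrite -[leRHS]mul1r ler_wpM2r //.
  exact: ltW.
- have [D D0 DP] : exists2 D : R, (0 < D)%R & forall x, (d x0 x < D)%R.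
    pose Q S := exists2 D : R, (0 < D)%R & forall x, S x -> (d x0 x < D)%R.
    suff [D D0 DP] : Q [set: X] by exists D => // x; exact: DP.
    apply: compact_induction => //.
    + by exists 1%R.
    + by move=> A A' AA' [D D0 DP]; exists D => // x /AA' /DP.
    + move=> A A' [D D0 DP] [D' D0' DP']; exists (D + D')%R; first exact: addr_gt0.
      move=> x [/DP|/DP'] H; apply: (lt_trans H); first by rewrite ltrDl.
      by rewrite ltrDr.
    + move=> x _; exists [set y | (d x y < 1)%R]; first exact: (ballP x 1%R ltr01).
      exists (d x0 x + 1)%R; first by rewrite ltr_wpDl.
      move=> y [_ /= xy]; apply: le_lt_trans (dtri x0 x y) _.
      by rewrite ltrD2l.
  move=> V oV covV.
  (* A Lebesgue number, obtained by halving radii locally. *)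
  have [r r0 rP] : exists2 r : R, (0 < r)%R &
      forall x, exists2 W, V W & forall y, (d x y < r)%R -> W y.
    pose Q S := exists2 r : R, (0 < r)%R &
      forall x, S x -> exists2 W, V W & forall y, (d x y < r)%R -> W y.
    suff [r r0 rP] : Q [set: X] by exists r => // x; exact: rP.
    apply: compact_induction => //.
    + by exists 1%R.
    + by move=> A A' AA' [r r0 rP]; exists r => // x /AA' /rP.
    + move=> A A' [r r0 rP] [r' r0' rP']; exists (Num.min r r').
        by rewrite lt_min r0.
      by move=> x [/rP|/rP'][W VW WP]; exists W => // y; rewrite lt_min => /andP[? ?]; exact: WP.
    + move=> x _; have [W VW Wx] : (\bigcup_(W in V) W) x by rewrite covV.
      have : nbhs x W by apply: open_nbhs_nbhs; split => //; exact: oV.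
      rewrite gend => -[r /= r0 rW]; have r20 : (0 < r / 2)%R by rewrite divr_gt0.
      exists [set y | (d x y < r / 2)%R]; first by exists (r / 2)%R.
      exists (r / 2)%R => // y [_ /= xy]; exists W => // z yz; apply: rW => /=.
      by apply: le_lt_trans (dtri x y z) _; rewrite [ltRHS]splitr ltrD.
  have [n nP] : exists n, (lam ^+ n * D < r)%R.
    have nlam1 : (`|lam| < 1)%R by rewrite ger0_norm.
    have rD : (0 < r / D)%R by rewrite divr_gt0.
    have /cvgr0Pnorm_lt/(_ _ rD)[n _ /(_ n (leqnn n))] := cvg_expr nlam1.
    by rewrite ger0_norm ?exprn_ge0 // => en; exists n; rewrite -ltr_pdivlMr.
  exists n => fs Ffs; pose w := \big[comp/idfun]_(i < n) fs i.
  have wP x : (d (w x0) (w x) <= lam ^+ n * d x0 x)%R.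
    rewrite /w {w nP}; elim: n fs Ffs => [|n IH] fs Ffs.
      by rewrite big_ord0 expr0 mul1r.
    rewrite big_ord_recl /= exprS -mulrA; apply: le_trans (lamP _ (Ffs ord0) _ _) _.
    by rewrite ler_wpM2l //; apply: (IH (fun i => fs (lift ord0 i))) => i; exact: Ffs.
  have [W VW WP] := rP (w x0); exists W => // _ [x _ <-]; apply: WP.
  apply: le_lt_trans (wP x) _; apply: le_lt_trans nP.
  by rewrite ler_wpM2l ?exprn_ge0 // ltW.
Qed.

(** * Topological fractals have no limit height *)

Lemma seq_directed (T : eqType) (I : Type) (le : I -> I -> Prop)
    (P : T -> I -> Prop) (l : seq T) :
  inhabited I -> (forall i j, exists k, le i k /\ le j k) ->
  (forall p i j, le i j -> P p i -> P p j) ->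
  (forall p, p \in l -> exists i, P p i) ->
  exists i, forall p, p \in l -> P p i.
Proof.
move=> [i0] dir mono; elim: l => [|q l IH] ex; first by exists i0.
have [|i iP] := IH; first by move=> p pl; apply: ex; rewrite inE pl orbT.
have [j jP] := ex q (mem_head _ _); have [k [ik jk]] := dir i j.
exists k => p; rewrite inE => /orP[/eqP->|pl]; first exact: mono jk jP.
exact: mono ik (iP p pl).
Qed.

Lemma nbhs_forall_seq (X : topologicalType) (T : eqType) (x : X)
    (A : T -> set X) (l : seq T) :
  (forall p, p \in l -> nbhs x (A p)) ->
  nbhs x [set y | forall p, p \in l -> A p y].
Proof.
elim: l => [|q l IH] nA; first by apply: filterS filterT.
have nl : nbhs x [set y | forall p, p \in l -> A p y].
  by apply: IH => p pl; apply: nA; rewrite inE pl orbT.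
apply: filterS (filterI (nA q (mem_head _ _)) nl) => y [Aq Al] p.
by rewrite inE => /orP[/eqP->//|]; exact: Al.
Qed.

Section FractalHeight.
Variables (X : topologicalType) (B : nat -> set X) (F : set (X -> X)).
Hypothesis compactX : compact [set: X].
Hypothesis baseB : clopen_base B.
Hypothesis finF : finite_set F.
Hypothesis contF : forall f, F f -> continuous f.
Hypothesis covF : covered_by_images F.

(** Otherwise compactness of the fibres gives one earlier stage in which no preimage of [y] is an
    accumulation point. By induction, points of that stage near [y] have preimages in it, which are
    forced into the fibres, so [y] would be isolated there. *)
Lemma CB_covered a y : CB_derivative X a y ->
  exists f z, [/\ F f, CB_derivative X a z & f z = y].
Proof.
have [cB _ sepB] := baseB; have [l Fl] := (finite_seqP F).1 finF.
elim: a y => I g IH y ay; apply: contrapT => nfz.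
have fz f z : F f -> f z = y -> exists i, ~ derived_set (CB_derivative X (g i)) z.
  move=> Ff fzy; apply: contrapT => ni; apply: nfz; exists f, z; split => // i _.
  by apply: contrapT => nd; apply: ni; exists i.
have clfy f : F f -> compact [set z | f z = y].
  move=> Ff; apply: closed_compact_space => //.
  exact: ((continuous_closedP f).1 (contF Ff) _ (closed_point baseB (q := y))).
have I0 : inhabited I.
  have : (\bigcup_(f in F) range f) y by rewrite -covF.
  by move=> [f Ff [z _ /(fz f z Ff)[i _]]].
have [i iP] : exists i, forall f, f \in l -> forall z, f z = y ->
    ~ derived_set (CB_derivative X (g i)) z.
  apply: (@seq_directed _ _ (fun i j => derived_set (CB_derivative X (g j)) `<=`
      derived_set (CB_derivative X (g i)))) => //.
  - move=> i j; have [ij|ji] := @CB_nested X (succ_ord (g i)) (succ_ord (g j)).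
      by exists i; rewrite -!CB_succE; split.
    by exists j; rewrite -!CB_succE; split.
  - by move=> f i j ij iP z /iP nz /ij.
  - move=> f fl; have Ff : F f by rewrite Fl.
    have [i|i j|z fzy|i ei] := nested_closed_empty
        (C := fun i => derived_set (CB_derivative X (g i))) (clfy f Ff) I0.
    + exact/closed_derived_set/CB_closed.
    + by rewrite -!CB_succE; exact: CB_nested.
    + exact: fz fzy.
    + exists i => z fzy dz.
      by have : ([set z | f z = y] `&` derived_set (CB_derivative X (g i))) z by []; rewrite ei.
have [V yV VP] : exists2 V, nbhs y V & forall v, V v -> forall f, f \in l ->
    forall w, f w = v -> CB_derivative X (g i) w -> v = y.
  exists [set v | forall f, f \in l -> forall w, f w = v -> CB_derivative X (g i) w -> v = y] => //.
  apply: nbhs_forall_seq => f fl; have Ff : F f by rewrite Fl.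
  (* Near a point of the fibre, the stage contains at most that point; a point off the fibre is
     mapped into a basic set whose complement is a neighbourhood of [y]. *)
  pose Q S := nbhs y [set v | forall w, S w -> f w = v -> CB_derivative X (g i) w -> v = y].
  have : Q setT.
    apply: compact_induction => //.
    - by rewrite /Q; apply: filterS filterT => v _ w [].
    - by move=> A A' AA'; rewrite /Q; apply: filterS => v H w /AA'; exact: H.
    - move=> A A'; rewrite /Q => QA QA'; apply: filterS (filterI QA QA') => v [H H'] w [/H|/H']; exact.
    - move=> z _; have [fzy|fzy] := pselect (f z = y).
        have : exists2 N, nbhs z N & forall w, N w -> CB_derivative X (g i) w -> w = z.
          apply: contrapT => nN; have [az|naz] := pselect (CB_derivative X (g i) z).
            apply: (iP f fl z fzy); apply/derived_setP; split => // N zN.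
            apply: contrapT => nw; apply: nN; exists N => // w Nw aw.
            by apply: contrapT => wz; apply: nw; exists w.
          apply: nN; exists (~` CB_derivative X (g i)) => //.
          by apply: open_nbhs_nbhs; split => //; exact/closed_openC/CB_closed.
        move=> [N zN NP]; exists N => //; rewrite /Q; apply: filterS filterT => v _ w [_ Nw] <- aw.
        by rewrite (NP w Nw aw).
      have [n Bfz nBy] := sepB _ _ fzy; exists (f @^-1` B n).
        by apply: contF => //; apply: open_nbhs_nbhs; split => //; case: (cB n).
      have nV : nbhs y (~` B n).
        by apply: open_nbhs_nbhs; split => //; case: (clopenC set0 (cB n)).
      by rewrite /Q; apply: filterS nV => v nBv w [_ /= Bfw] fwv; rewrite fwv in Bfw.
  by rewrite /Q; apply: filterS => v H w; exact: H.
have /derived_setP[_ /(_ V yV)[v [Vv av vy]]] := ay i Logic.I.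
have [f [w [Ff aw fw]]] := IH i v av.
have fl : f \in l by move: Ff; rewrite Fl.
by apply: vy; exact: (VP v Vv f fl w fw aw).
Qed.

Hypothesis contractF : topologically_contracting F.

Lemma contracting_not_limit :
  scattered X -> [set: X] !=set0 -> ~ is_limit_ord (ord_sup (@rank X)).
Proof.
move=> scX X0 [nzero nsucc]; have [cB _ sepB] := baseB.
have [P0 sP] := CB_height compactX scX X0.
move: nzero nsucc P0 sP; set top := ord_sup _ => nzero nsucc P0 sP.
pose P := CB_derivative X top.
(* A chain of stages intersecting in [P]; each requirement below is met by going far enough along
   it. *)
pose D (i : ord_index top) := CB_derivative X (succ_ord (ord_child i)).
have PE x : P x <-> forall i, D i x.
  rewrite /P /D; case: (top) => I g; split=> [gx i|gx i _].
    by rewrite CB_succE; exact: gx.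
  by have := gx i; rewrite CB_succE.
have I0 : inhabited (ord_index top).
  apply: contrapT => nI; apply: nzero; move: nI; case: (top) => I g nI.
  by split=> [i|[]]; case: nI.
have Dnest i j : D i `<=` D j \/ D j `<=` D i by exact: CB_nested.
have Ddir i j : exists k, D k `<=` D i /\ D k `<=` D j.
  by have [ij|ji] := Dnest i j; [exists i|exists j]; split.
have notP x : ~ P x -> exists i, ~ D i x.
  move=> nPx; apply: contrapT => ni; apply/nPx/PE => i.
  by apply: contrapT => nD; apply: ni; exists i.
have [l Fl] := (finite_seqP F).1 finF.
have [lP PlP] : exists lP : seq X, P = [set` lP].
  apply/finite_seqP/closed_discrete_finite.
    by apply: closed_compact_space => //; exact: CB_closed.
  move=> x Px; apply: contrapT => nN.
  have : CB_derivative X (succ_ord top) x.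
    rewrite CB_succE; apply/derived_setP; split => // N xN.
    apply: contrapT => ny; apply: nN; exists N => // y [Py Ny].
    by apply: contrapT => yx; apply: ny; exists y.
  by rewrite sP.
have memP p : p \in lP <-> P p by rewrite PlP.
have memF f : f \in l <-> F f by rewrite Fl.
pose sim N x y := forall n, (n < N)%N -> B n x <-> B n y.
have sim_nbhs N x : nbhs x [set y | sim N x y].
  apply: filterS (@nbhs_forall_seq X nat x (fun n => [set y | B n x <-> B n y]) (iota 0 N) _).
    by move=> y H n nN; apply: H; rewrite mem_iota.
  move=> n _; have [Bx|nBx] := pselect (B n x).
    apply: (@filterS _ _ _ (B n)); first by move=> y.
    by apply: open_nbhs_nbhs; split => //; case: (cB n).
  apply: (@filterS _ _ _ (~` B n)); first by move=> y /= nBy; split.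
  by apply: open_nbhs_nbhs; split => //; case: (clopenC set0 (cB n)).
(* Finitely many basic sets suffice to tell the finitely many points of [P] apart. *)
have [N simP] : exists N, forall p q, P p -> P q -> sim N p q -> p = q.
  have [||p|N NP] := @seq_directed _ nat leq
      (fun p N => forall q, q \in lP -> sim N p q -> p = q) lP (inhabits 0%N).
  - by move=> i j; exists (maxn i j); rewrite leq_maxl leq_maxr.
  - by move=> p i j ij H q ql s; apply: H => // n ni; apply: s; exact: leq_trans ij.
  - move=> pl.
    apply: (@seq_directed _ nat leq (fun q N => sim N p q -> p = q) lP (inhabits 0%N)).
    + by move=> i j; exists (maxn i j); rewrite leq_maxl leq_maxr.
    + by move=> q i j ij H s; apply: H => n ni; apply: s; exact: leq_trans ij.
    + move=> q ql; have [->|pq] := pselect (p = q); first by exists 0%N.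
      have [n Bp nBq] := sepB _ _ pq; exists n.+1 => /(_ n (leqnn _)) [/(_ Bp)].
      by [].
  - by exists N => p q /memP pl /memP ql; exact: NP.
have [i1 i1P] : exists i, forall p, p \in lP -> forall f, f \in l -> ~ P (f p) -> ~ D i (f p).
  apply: (@seq_directed _ _ (fun i j => D j `<=` D i)) => //.
    by move=> p i j ij H f fl nP /ij; exact: H.
  move=> p pl; apply: (@seq_directed _ _ (fun i j => D j `<=` D i)) => //.
    by move=> f i j ij H nP /ij; exact: H.
  move=> f fl; have [Pf|/notP[i nD]] := pselect (P (f p)); last by exists i.
  by have [i] := I0; exists i.
(* Points of [U p] resemble [p], and so do their images, except that images of [p] outside [P] only
   have to be lost by stage [i1]. *)
pose U p := [set x | sim N p x /\ forall f, f \in l ->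
  (P (f p) -> sim N (f p) (f x)) /\ (~ P (f p) -> ~ D i1 (f x))].
have U_nbhs p : P p -> nbhs p (U p).
  move=> Pp; apply: filterI; first exact: sim_nbhs.
  apply: nbhs_forall_seq => f /[dup] fl /memF Ff.
  have [Pf|nPf] := pselect (P (f p)).
    have nS : nbhs p (f @^-1` [set y | sim N (f p) y]).
      exact: (@contF f Ff p _ (sim_nbhs N (f p))).
    by apply: filterS nS => x /= s; split.
  have nD : nbhs (f p) (~` D i1).
    apply: open_nbhs_nbhs; split; first exact/closed_openC/CB_closed.
    by apply: i1P => //; exact/memP.
  have nS : nbhs p (f @^-1` (~` D i1)) by exact: (@contF f Ff p _ nD).
  by apply: filterS nS => x /= s; split.
have [i2 i2P] : exists i, forall x, D i x -> exists2 p, P p & U p x.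
  pose Q S := exists i, forall x, S x -> D i x -> exists2 p, P p & U p x.
  suff [i iP] : Q setT by exists i => x; exact: iP.
  apply: compact_induction => //.
  - by have [i] := I0; exists i.
  - by move=> A A' AA' [i H]; exists i => x /AA'; exact: H.
  - move=> A A' [i H] [j H']; have [k [ki kj]] := Ddir i j.
    by exists k => x [/H + /ki|/H' + /kj]; apply.
  - move=> x _; have [Px|/notP[i nD]] := pselect (P x).
      exists (U x); first exact: U_nbhs.
      by have [i] := I0; exists i => y [_ Uy] _; exists x.
    exists (~` D i); last by exists i => y [].
    by apply: open_nbhs_nbhs; split => //; exact/closed_openC/CB_closed.
have [i [ii1 ii2]] := Ddir i1 i2.
(* Were [D i] inside [P], it would have no isolated point, since its index is below [top] by the
   failure of [top] to be a successor; but stage [succ_ord top] is empty. *)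
have [y Dy nPy] : exists2 y, D i y & ~ P y.
  apply: contrapT => ny.
  have DP : D i `<=` P by move=> x Dx; apply: contrapT => nPx; apply: ny; exists x.
  have [x Px] := P0; have Dx : D i x by exact: (PE x).1.
  have : CB_derivative X (succ_ord top) x.
    apply: (derived_sub_CB (A := D i)) Dx => z /DP Pz.
    have [top_le|lt_top] := ord_le_or_lt top (succ_ord (ord_child i)).
      by case: nsucc; exists (ord_child i); split => //; exact: (ord_child_lt i).
    by rewrite -CB_succE; exact: CB_derivative_anti lt_top _ Pz.
  by rewrite sP.
(* A backward orbit of [y] stays close to a backward orbit inside [P], so that
   the image of every composite reaching [y] also meets [P]. *)
have words n : forall z p, D i z -> P p -> U p z -> exists fs : 'I_n -> X -> X,
    [/\ forall j, F (fs j), range (\big[comp/idfun]_(j < n) fs j) z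
      & range (\big[comp/idfun]_(j < n) fs j) p].
  elim: n => [|n IH] z p Dz Pp [pz _].
    by exists (fun=> id); split=> [[]//||]; rewrite big_ord0; [exists z|exists p].
  have [f [w [Ff Dw fwz]]] := CB_covered Dz.
  have [q Pq [qw Uw]] := i2P w (ii2 _ Dw).
  have [Pfq nPfq] := Uw f ((memF f).2 Ff).
  (* As [f w = z] survives stage [i1], the point [f q] cannot lie outside [P]; then [f q] and [p]
     both resemble [z], hence are equal. *)
  have {nPfq}Pf : P (f q).
    by apply: contrapT => /nPfq; apply; rewrite fwz; exact: ii1.
  have fqp : f q = p.
    apply: simP => // m mN; have := Pfq Pf m mN; rewrite fwz.
    by have := pz m mN; tauto.
  have [fs [Ffs [x1 _ e1] [x2 _ e2]]] := IH w q Dw Pq (conj qw Uw).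
  exists (fun j => if unlift ord0 j is Some j' then fs j' else f).
  have -> : \big[comp/idfun]_(j < n.+1) (if unlift ord0 j is Some j' then fs j' else f) =
      f \o \big[comp/idfun]_(j < n) fs j.
    rewrite big_ord_recl unlift_none; congr (_ \o _).
    by apply: eq_bigr => j _; rewrite liftK.
  split=> [j||]; first by case: unliftP.
  - by exists x1 => //=; rewrite e1.
  - by exists x2 => //=; rewrite e2.
have [p Pp Up] := i2P y (ii2 _ Dy).
(* No member of this cover contains both [y] and a point of [P]. *)
have [||n nP] := contractF (U := [set ~` [set y]; ~` P]).
- by move=> _ [->|->]; apply: closed_openC; [exact: (closed_point baseB)|exact: CB_closed].
- apply/seteqP; split=> // z _; have [zy|zy] := pselect (z = y).
    by exists (~` P); [right|rewrite zy].
  by exists (~` [set y]); [left|].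
- have [fs [Ffs wy wp]] := words n y p Dy Pp Up.
  have [W [->|->] WP] := nP fs Ffs; first exact: (WP y wy).
  exact: (WP p wp).
Qed.

End FractalHeight.

Lemma fractal_height (R : realType) (X : topologicalType) :
  has_clopen_base X -> compact [set: X] -> metrizable R X ->
  topological_fractal X ->
  ~ (exists a : Ord, [/\ scattered_height X = Some a,
                         countable_ord a & is_limit_ord a]).
Proof.
move=> hzero compactX hmetr [_ [F [finF contF covF contrF]]].
have [B baseB] := countable_clopen_base hzero compactX hmetr.
move=> [a []]; rewrite /scattered_height; case: asboolP => // scX [<-] _ lim.
have [X0|nX] := pselect ([set: X] !=set0).
  exact: contracting_not_limit compactX baseB finF contF covF contrF scX X0 lim.
case: lim => nzero _; apply: nzero; split=> [[x ?]|[]].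
by case: nX; exists x.
Qed.

(** Each ordinal below the height has a stage with an isolated point, isolated by some [B n]. This
    [n] determines the ordinal: a point of a later stage is an accumulation point of the earlier
    one, which [B n] would not isolate. *)
Lemma scattered_height_countable (X : topologicalType) (B : nat -> set X) :
  clopen_base B -> scattered X -> countable_ord (ord_sup (@rank X)).
Proof.
move=> [cB baseB _] scX.
pose iso n b := exists x, [/\ CB_derivative X b x, B n x &
  forall z, B n z -> CB_derivative X b z -> z = x].
exists (fun n => if pselect (exists b, iso n b) is left h then projT1 (cid h) else zero_ord).
move=> b /(_ tt)[[x i] /= bi].
have bx : CB_derivative X b x.
  have [xr _] := rank_spec ((scatteredP X).1 scX x).
  apply: CB_derivative_anti xr.
  exact: ord_le_trans bi (ord_le_trans (ord_le_succ _) (ord_child_lt i)).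
have [z [/set_mem bz [N zN Nb]]] := scX _ (ex_intro _ x bx).
have [n Bz BN] := baseB z N zN.
have ison : iso n b.
  exists z; split => // w /BN Nw bw.
  by have : (N `&` CB_derivative X b) w by []; rewrite Nb.
exists n; case: pselect => [h|[]]; last by exists b.
case: cid => c /= isoc.
have le_iso b1 b2 : iso n b1 -> iso n b2 -> ord_le b2 b1.
  move=> [x1 [b1x Bx1 iso1]] [x2 [b2x Bx2 iso2]].
  have [//|lt12] := ord_le_or_lt b2 b1.
  have sx2 : CB_derivative X (succ_ord b1) x2 by exact: CB_derivative_anti lt12 _ b2x.
  move: (sx2); rewrite CB_succE => /derived_setP[b1x2 /(_ (B n))[]].
    by apply: open_nbhs_nbhs; split => //; case: (cB n).
  move=> w [Bw b1w wx2]; case: wx2.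
  by rewrite (iso1 w Bw b1w) (iso1 x2 Bx2 b1x2).
by split; exact: le_iso.
Qed.

Lemma height_not_limit (R : realType) (X : topologicalType) :
  has_clopen_base X -> compact [set: X] -> metrizable R X ->
  ~ (exists a : Ord, [/\ scattered_height X = Some a,
                         countable_ord a & is_limit_ord a]) ->
  scattered_height X = None \/
    (exists a : Ord, scattered_height X = Some a /\
       (is_zero_ord a \/ (countable_ord a /\ is_succ_ord a))).
Proof.
move=> hzero compactX hmetr nlim.
have [B baseB] := countable_clopen_base hzero compactX hmetr.
move: nlim; rewrite /scattered_height; case: asboolP => [scX nlim|]; last by left.
have ctop := scattered_height_countable baseB scX.
right; exists (ord_sup (@rank X)); split => //.
have [|nzero] := pselect (is_zero_ord (ord_sup (@rank X))); first by left.
right; split => //; apply: contrapT => nsucc; apply: nlim.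
by exists (ord_sup (@rank X)).
Qed.

Theorem theorem1 (R : realType) (X : topologicalType)
  (hzero : has_clopen_base X)
  (hcompact : compact [set: X])
  (hmetrizable : metrizable R X) :
  [<-> topological_fractal X;
       Banach_fractal R X;
       Banach_ultrafractal R X;
       ~ (exists a : Ord, [/\ scattered_height X = Some a,
                              countable_ord a & is_limit_ord a]);
       scattered_height X = None \/
       (exists a : Ord, scattered_height X = Some a /\
          (is_zero_ord a \/ (countable_ord a /\ is_succ_ord a)))].
Proof.
(* The implications form one cycle: topological fractal, no limit height, admissible height,
   ultrafractal, Banach fractal, topological fractal. *)
have h03 := fractal_height hzero hcompact hmetrizable.
have h34 := height_not_limit hzero hcompact hmetrizable.
have h42 := @height_ultrafractal R X hzero hcompact hmetrizable.
have h21 := @ultrafractal_Banach R X hmetrizable.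
have h10 := @Banach_topological R X.
by split; [|split; [|split; [|split]]]; tauto.
Qed.
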